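(* Fix $t_0\in[0,1]$ and $\zeta_0\notin\mathrm{Spec}(H_{t_0})$, and for $\epsilon>0$ put $\mathcal U_\epsilon=\{(t,\zeta)\in[0,1]\times\mathbb C:|t-t_0|\le\epsilon,\ |\zeta-\zeta_0|\le\epsilon\}$. (1) Assume $\|(\mathcal A_t-\mathbf i)^{-1}\|_{\mathcal B(\mathcal H,\mathcal D)}=\mathcal O(1)$ as $t\to t_0$ and that $t\mapsto\mathrm T_t$, $t\mapsto V_t$, $t\mapsto Q_t$ are continuous at $t_0$. Then there exists $\varepsilon>0$ such that if $(t,\zeta)\in\mathcal U_\varepsilon$ then $\zeta\notin\mathrm{Spec}(H_t)$, and the function $t\mapsto R_t(\zeta)=(H_t-\zeta)^{-1}$ is continuous at $t_0$ (in $\mathcal B(\mathcal H)$) uniformly for $|\zeta-\zeta_0|<\varepsilon$. (2) Assume $\|(\mathcal A_t-\mathbf i)^{-1}\|_{\mathcal B(\mathcal H,\mathcal D)}=\mathcal O(1)$ as $t\to t_0$ and that $t\mapsto\mathrm T_t$, $t\mapsto V_t$, $t\mapsto Q_t$ are Lipschitz continuous at $t_0$. Then, for some $\varepsilon>0$ as in (1), there exists a constant $c>0$ such that for all $(t,\zeta)\in\mathcal U_\varepsilon$ $$\|R_t(\zeta)-R_{t_0}(\zeta)\|_{\mathcal B(\mathcal H)}\le c|t-t_0|.$$ (3) Assume $\|(\mathcal A_t-\mathbf i)^{-1}-(\mathcal A_{t_0}-\mathbf i)^{-1}\|_{\mathcal B(\mathcal H,\mathcal D)}=o(1)$ as $t\to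 t_0$ and that $t\mapsto\mathrm T_t$, $t\mapsto V_t$, $t\mapsto Q_t$ are differentiable at $t_0$. Then for some $\varepsilon>0$ the following expansion holds in $\mathcal B(\mathcal H)$ as $t\to t_0$, uniformly for $|\zeta-\zeta_0|<\varepsilon$: $$R_t(\zeta)=R_{t_0}(\zeta)+\Big(-R_{t_0}(\zeta)\dot V_{t_0}R_{t_0}(\zeta)+(\mathrm T_{t_0}R_{t_0}(\overline\zeta))^*\dot Q_{t_0}J\,\mathrm T_{t_0}R_{t_0}(\zeta)+(\mathrm T_{t_0}R_{t_0}(\overline\zeta))^*J\,\dot{\mathrm T}_{t_0}R_{t_0}(\zeta)\Big)(t-t_0)+o(t-t_0).$$ In particular, $t\mapsto R_t(\zeta_0)$ is differentiable at $t=t_0$ and satisfies the Riccati equation $$\dot R_{t_0}(\zeta_0)=-R_{t_0}(\zeta_0)\dot V_{t_0}R_{t_0}(\zeta_0)+(\mathrm T_{t_0}R_{t_0}(\overline{\zeta_0}))^*\dot Q_{t_0}J\,\mathrm T_{t_0}R_{t_0}(\zeta_0)+(\mathrm T_{t_0}R_{t_0}(\overline{\zeta_0}))^*J\,\dot{\mathrm T}_{t_0}R_{t_0}(\zeta_0).$$ Here operators whose adjoints appear are considered as elements of $\mathcal B(\mathcal H,\mathfrak H\times\mathfrak H)$.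
   Context: Inner products are linear in the first argument. $\mathcal H,\mathfrak H$ are complex separable Hilbert spaces; $A$ is a densely defined, closed, symmetric operator in $\mathcal H$ with equal (possibly infinite) deficiency indices; $\mathcal H_+:=\mathrm{dom}(A^* )$ carries the graph inner product $\langle u,v\rangle_{\mathcal H}+\langle A^*u,A^*v\rangle_{\mathcal H}$. $\mathcal D$ is a dense subspace of $\mathcal H_+$ with $\mathrm{dom}(A)\subset\mathcal D$, equipped with a Banach norm $\|\cdot\|_{\mathcal D}$ for which the embedding $\mathcal D\hookrightarrow\mathcal H_+$ is bounded. For each $t\in[0,1]$, the trace operator $\mathrm T_t=[\Gamma_{0t},\Gamma_{1t}]^\top\in\mathcal B(\mathcal D,\mathfrak H\times\mathfrak H)$ has dense range and satisfies $\langle A^*u,v\rangle_{\mathcal H}-\langle u,A^*v\rangle_{\mathcal H}=\langle\Gamma_{1t}u,\Gamma_{0t}v\rangle_{\mathfrak H}-\langle\Gamma_{0t}u,\Gamma_{1t}v\rangle_{\mathfrak H}$ for $u,v\in\mathcal D$. $J=\begin{bmatrix}0&I_{\mathfrak H}\\-I_{\mathfrak H}&0\end{bmatrix}$, $\omega(f,g)=\langle Jf,g\rangle_{\mathfrak H\times\mathfrak H}$; a subspace $\mathcal F\subset\mathfrak H\times\mathfrak H$ is Lagrangian if it equals $\{f:\omega(f,g)=0\ \forall g\in\mathcal F\}$. For each $t\in[0,1]$: $Q_t$ is an orthogonal projection in $\mathfrak H\times\mathfrak H$ whose range is Lagrangian; $\mathcal A_t$ is a self-adjoint extension of $A$ with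 $\mathrm{dom}(\mathcal A_t)\subset\mathcal D$ and $\overline{\mathrm T_t(\mathrm{dom}(\mathcal A_t))}=\mathrm{ran}(Q_t)$; $V_t\in\mathcal B(\mathcal H)$ is self-adjoint; $H_t:=\mathcal A_t+V_t$ and $R_t(\zeta):=(H_t-\zeta)^{-1}$. Continuity, Lipschitz continuity at $t_0$ and differentiability of $\mathrm T_t,V_t,Q_t$ are in the norms of $\mathcal B(\mathcal D,\mathfrak H\times\mathfrak H)$, $\mathcal B(\mathcal H)$, $\mathcal B(\mathfrak H\times\mathfrak H)$; Lipschitz continuous at $t_0$ means $\|f(t)-f(t_0)\|\le c|t-t_0|$ for $t$ near $t_0$. The dot is the $t$-derivative evaluated at $t_0$. *)

(* Defs.v *)
From HB Require Import structures.
From mathcomp Require Import all_boot all_order all_algebra.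
From mathcomp Require Import complex.
From mathcomp Require Import all_classical all_reals all_analysis.
From mathcomp Require Import ring lra.

Set Implicit Arguments.
Unset Strict Implicit.
Unset Printing Implicit Defensive.

Import Order.TTheory GRing.Theory Num.Theory.
Import numFieldNormedType.Exports.

Local Open Scope classical_set_scope.
Local Open Scope ring_scope.
Local Open Scope complex_scope.

(* [{dot H for Num.conj}] is linear in its first argument and conjugate-linear
   in the second one; the norm of [H] takes its values in [R[i]]. *)
HB.mixin Record isHilbert (R : realType) H
    & CompleteNormedModule R[i] H := {
  hdot : {dot H for @Num.conj R[i]};
  hdot_norm : forall x : H, `|x| ^+ 2 = hdot x x
}.

#[short(type="hilbertType")]
HB.structure Definition Hilbert (R : realType) :=
  {H of isHilbert R H & CompleteNormedModule R[i] H}.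

(* The library norm on a product is the max norm, hence the alias [hsum], which
   carries the Hilbert norm [|x|^2 = |x.1|^2 + |x.2|^2]. *)
Definition hsum (U V : Type) : Type := (U * V)%type.

Section HilbertSum.
Context {R : realType} (U V : hilbertType R).
Local Notation UV := (hsum U V).

HB.instance Definition _ := GRing.Lmodule.copy UV (U * V)%type.

Definition hsum_norm (x : UV) : R[i] := sqrtC (`|x.1| ^+ 2 + `|x.2| ^+ 2).

Let hsum_norm2 (x : UV) : hsum_norm x ^+ 2 = `|x.1| ^+ 2 + `|x.2| ^+ 2.
Proof. by rewrite sqrtCK. Qed.

Let hsum_norm_ge0 (x : UV) : 0 <= hsum_norm x.
Proof. by rewrite sqrtC_ge0 addr_ge0 // exprn_ge0. Qed.

Let normr_fst (x : UV) : `|x.1| <= hsum_norm x.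
Proof.
by rewrite -(@ler_pXn2r _ 2) ?nnegrE // hsum_norm2 lerDl exprn_ge0.
Qed.

Let normr_snd (x : UV) : `|x.2| <= hsum_norm x.
Proof.
by rewrite -(@ler_pXn2r _ 2) ?nnegrE // hsum_norm2 lerDr exprn_ge0.
Qed.

Let hsum_normD (x y : UV) : hsum_norm (x + y) <= hsum_norm x + hsum_norm y.
Proof.
have s0 : 0 <= hsum_norm x + hsum_norm y by rewrite addr_ge0.
rewrite -(@ler_pXn2r _ 2) ?nnegrE // hsum_norm2 sqrrD !hsum_norm2.
have le1 : `|(x + y).1| ^+ 2 <= (`|x.1| + `|y.1|) ^+ 2.
  by rewrite ler_pXn2r ?nnegrE ?addr_ge0 // ler_normD.
have le2 : `|(x + y).2| ^+ 2 <= (`|x.2| + `|y.2|) ^+ 2.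
  by rewrite ler_pXn2r ?nnegrE ?addr_ge0 // ler_normD.
apply: (le_trans (lerD le1 le2)).
have cs : `|x.1| * `|y.1| + `|x.2| * `|y.2| <= hsum_norm x * hsum_norm y.
  rewrite -(@ler_pXn2r _ 2) ?nnegrE ?addr_ge0 ?mulr_ge0 //.
  rewrite exprMn !hsum_norm2 -subr_ge0.
  have -> : (`|x.1| ^+ 2 + `|x.2| ^+ 2) * (`|y.1| ^+ 2 + `|y.2| ^+ 2)
      - (`|x.1| * `|y.1| + `|x.2| * `|y.2|) ^+ 2
      = (`|x.1| * `|y.2| - `|x.2| * `|y.1|) ^+ 2 by ring.
  apply: real_exprn_even_ge0 => //.
rewrite -subr_ge0.
have -> : `|x.1| ^+ 2 + `|x.2| ^+ 2 + hsum_norm x * hsum_norm y *+ 2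
    + (`|y.1| ^+ 2 + `|y.2| ^+ 2)
    - ((`|x.1| + `|y.1|) ^+ 2 + (`|x.2| + `|y.2|) ^+ 2)
    = (hsum_norm x * hsum_norm y
       - (`|x.1| * `|y.1| + `|x.2| * `|y.2|)) *+ 2 by ring.
by rewrite mulrn_wge0 // subr_ge0.
Qed.

Let hsum_normZ (l : R[i]) (x : UV) : hsum_norm (l *: x) = `|l| * hsum_norm x.
Proof.
apply/eqP; rewrite -(@eqrXn2 _ 2) ?mulr_ge0 // exprMn !hsum_norm2 /=.
by rewrite !normrZ !exprMn mulrDr.
Qed.

Let hsum_norm0_eq0 (x : UV) : hsum_norm x = 0 -> x = 0.
Proof.
move=> x0; case: x x0 => a b x0.
have := normr_fst (a, b); have := normr_snd (a, b).
by rewrite x0 /= !normr_le0 => /eqP -> /eqP ->.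
Qed.

HB.instance Definition _ := Lmodule_isNormed.Build R[i] UV
  hsum_normD hsum_normZ hsum_norm0_eq0.

Let hsum_normE (x : UV) : `|x| = hsum_norm x. Proof. by []. Qed.

Let hsum_complete (F : set_system UV) : ProperFilter F -> cauchy F -> cvg F.
Proof.
move=> FF /cauchy_ballP Fc.
have F1c : cauchy (fst @ F : set_system U).
  apply/cauchy_ballP => e e0; have := Fc _ e0.
  rewrite !near_simpl => -[[A B] /= [FA FB] AB].
  exists (fst @` A, fst @` B) => /=.
    split; rewrite /nbhs /=.
      by apply: filterS FA => x Ax; exists x.
    by apply: filterS FB => x Bx; exists x.
  move=> [_ _] [/= [x Ax <-] [y By <-]].
  have := AB (x, y) (conj Ax By); rewrite -!ball_normE /= => h.
  exact: le_lt_trans (normr_fst (x - y)) h.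
have F2c : cauchy (snd @ F : set_system V).
  apply/cauchy_ballP => e e0; have := Fc _ e0.
  rewrite !near_simpl => -[[A B] /= [FA FB] AB].
  exists (snd @` A, snd @` B) => /=.
    split; rewrite /nbhs /=.
      by apply: filterS FA => x Ax; exists x.
    by apply: filterS FB => x Bx; exists x.
  move=> [_ _] [/= [x Ax <-] [y By <-]].
  have := AB (x, y) (conj Ax By); rewrite -!ball_normE /= => h.
  exact: le_lt_trans (normr_snd (x - y)) h.
have /cvg_ex[a Fa] : cvg (fst @ F : set_system U) by exact: cauchy_cvg.
have /cvg_ex[b Fb] : cvg (snd @ F : set_system V) by exact: cauchy_cvg.
apply/cvg_ex; exists ((a, b) : UV); apply/cvgrPdist_lt => e e0.
have e20 : 0 < e / 2 by rewrite divr_gt0.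
have /cvgrPdist_lt/(_ _ e20) Fa' := Fa.
have /cvgrPdist_lt/(_ _ e20) Fb' := Fb.
near=> x.
have na : `|a - x.1| < e / 2 by near: x; exact: Fa'.
have nb : `|b - x.2| < e / 2 by near: x; exact: Fb'.
rewrite hsum_normE -(@ltr_pXn2r _ 2) ?nnegrE // ?(ltW e0) //.
rewrite hsum_norm2 /=.
have -> : e ^+ 2 = (e / 2) ^+ 2 + (e / 2) ^+ 2 + (e / 2) ^+ 2 + (e / 2) ^+ 2.
  by field.
rewrite -addrA; apply: ltr_wpDr.
  by rewrite addr_ge0 // exprn_ge0 // ltW.
by apply: ltrD; rewrite ltr_pXn2r ?nnegrE // ltW.
Unshelve. all: by end_near. Qed.

HB.instance Definition _ := Uniform_isComplete.Build UV hsum_complete.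

Definition hsum_dot (x y : UV) : R[i] :=
  hdot x.1 y.1 + hdot x.2 y.2.

Let hsum_dot_bilinear :
  bilinear_for (GRing.Scale.Law.clone _ _ *%R _)
    (GRing.Scale.Law.clone _ _ (Num.conj \; *%R) _) hsum_dot.
Proof.
split=> [y|x] a u v /=.
  by rewrite /hsum_dot /= !linearPl /= mulrDr addrACA.
by rewrite /hsum_dot /= !linearPr /= mulrDr addrACA.
Qed.

HB.instance Definition _ := bilinear_isBilinear.Build R[i] UV UV R[i] _ _
  hsum_dot hsum_dot_bilinear.

Let hsum_dot_herm (x y : UV) :
  hsum_dot x y = (-1) ^+ false * Num.conj (hsum_dot y x).
Proof.
rewrite expr0 mul1r /hsum_dot rmorphD /=.
by congr (_ + _); rewrite [LHS]hermC expr0 mul1r.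
Qed.

HB.instance Definition _ := isHermitianSesquilinear.Build R[i] UV false
  (@Num.conj R[i]) hsum_dot hsum_dot_herm.

Let hsum_dot_norm (x : UV) : `|x| ^+ 2 = hsum_dot x x.
Proof. by rewrite hsum_normE hsum_norm2 !hdot_norm. Qed.

Let hsum_dot_gt0 (x : UV) : x != 0 -> 0 < hsum_dot x x.
Proof. by move=> x0; rewrite -hsum_dot_norm exprn_gt0 // normr_gt0. Qed.

HB.instance Definition _ := isDotProduct.Build R[i] UV hsum_dot hsum_dot_gt0.

HB.instance Definition _ := isHilbert.Build R UV hsum_dot_norm.

End HilbertSum.

(* The filter [t -> t0], [t != t0], within the parameter interval [[0, 1]]. *)
Definition at01 {R : realType} (t0 : R) : set_system R := within `[0, 1] t0^'.

Section OperatorNorm.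
Context {R : realType} {U V : normedModType R[i]}.

(* Operator norm, [+oo] for an unbounded operator. [complex.Re] only reads the
   norm, a nonnegative element of [R[i]], as a real number. *)
Definition opnorm (f : U -> V) : \bar R :=
  ereal_sup [set (complex.Re `|f x|)%:E | x in [set x : U | `|x| <= 1]].

End OperatorNorm.

Arguments opnorm {R U V} f%_ring_scope.

Section BoundedOperators.
Context {R : realType} {U V : normedModType R[i]}.

Definition bounded_op (f : U -> V) : Prop :=
  linear f /\ (opnorm f < +oo)%E.

Definition op_continuous (F : R -> U -> V) (t0 : R) : Prop :=
  opnorm (F t \- F t0) @[t --> at01 t0] --> 0%E.

Definition op_lipschitz (F : R -> U -> V) (t0 : R) : Prop :=
  exists c : R, \forall t \near at01 t0,
    (opnorm (F t \- F t0) <= (c * `|t - t0|)%:E)%E.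

Definition op_derivative (F : R -> U -> V) (t0 : R) (F' : U -> V) : Prop :=
  bounded_op F' /\
  opnorm (fun x => (t - t0)%:C^-1 *: (F t x - F t0 x) - F' x)
    @[t --> at01 t0] --> 0%E.

End BoundedOperators.

Section HilbertOperators.
Context {R : realType}.

Definition separable (H : hilbertType R) : Prop :=
  exists2 S : set H, countable S & dense S.

Definition orthonormal_basis (H : hilbertType R) (M S : set H) : Prop :=
  [/\ S `<=` M,
      forall x, S x -> hdot x x = 1,
      forall x y, S x -> S y -> x <> y -> hdot x y = 0 &
      forall x, M x -> (forall y, S y -> hdot x y = 0) -> x = 0].

(* [same_hilbert_dim M N]: the closed subspaces [M] and [N] have the same,
   possibly infinite, Hilbert dimension. *)
Definition same_hilbert_dim (H : hilbertType R) (M N : set H) : Prop :=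
  exists S S' : set H,
    [/\ orthonormal_basis M S, orthonormal_basis N S' & (S #= S')%card].

(* Adjoint of the operator [f] with domain [dm]; it is meaningful on the vectors
   at which a representing vector exists, and unique when [dm] is dense. *)
Definition adjoint_graph (H K : hilbertType R) (dm : set H) (f : H -> K)
    (v : K) : set H :=
  [set w | forall u, dm u -> hdot (f u) v = hdot u w].

Definition adjoint_fun (H K : hilbertType R) (dm : set H) (f : H -> K) :
    K -> H :=
  fun v => xget 0 (adjoint_graph dm f v).

Definition bounded_adjoint (H K : hilbertType R) (f : H -> K) : K -> H :=
  adjoint_fun setT f.

Definition selfadjoint_bounded (H : hilbertType R) (f : H -> H) : Prop :=
  bounded_op f /\ forall x y, hdot (f x) y = hdot x (f y).

Definition orthogonal_projection (H : hilbertType R) (Q : H -> H) : Prop :=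
  selfadjoint_bounded Q /\ forall x, Q (Q x) = Q x.

End HilbertOperators.

(* Possibly unbounded operators; the values of [act] outside [dom] are
   irrelevant. *)
Record operator (H : Type) := Operator {
  dom : set H;
  act :> H -> H
}.

Section UnboundedOperators.
Context {R : realType} {H : hilbertType R}.
Implicit Types (A B : operator H) (z : R[i]).

Definition linear_operator A : Prop :=
  dom A 0 /\
  forall (a : R[i]) u v, dom A u -> dom A v ->
    dom A (a *: u + v) /\ A (a *: u + v) = a *: A u + A v.

Definition extends B A : Prop :=
  dom A `<=` dom B /\ forall u, dom A u -> B u = A u.

Definition adjoint A : operator H := {|
  dom := [set v | adjoint_graph (dom A) A v !=set0];
  act := adjoint_fun (dom A) A |}.

Definition densely_defined A : Prop := dense (dom A).

Definition closed_operator A : Prop :=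
  closed [set p : H * H | dom A p.1 /\ p.2 = A p.1].

Definition symmetric_operator A : Prop :=
  forall u v, dom A u -> dom A v -> hdot (A u) v = hdot u (A v).

Definition selfadjoint A : Prop :=
  [/\ linear_operator A, densely_defined A,
      extends A (adjoint A) & extends (adjoint A) A].

Definition eigenspace A z : set H := [set u | dom A u /\ A u = z *: u].

Definition equal_deficiency_indices A : Prop :=
  same_hilbert_dim (eigenspace (adjoint A) 'i) (eigenspace (adjoint A) (- 'i)).

Definition graph_norm A (u : H) : R :=
  Num.sqrt (complex.Re (hdot u u + hdot (A u) (A u))).

Definition perturb A (V : H -> H) : operator H := {|
  dom := dom A;
  act := fun u => A u + V u |}.

Definition resolvent A z : H -> H :=
  fun f => xget 0 [set u | dom A u /\ A u - z *: u = f].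

Definition resolvent_set A : set R[i] :=
  [set z | (forall f, exists! u, dom A u /\ A u - z *: u = f) /\
           bounded_op (resolvent A z)].

Definition spectrum A : set R[i] := ~` resolvent_set A.

End UnboundedOperators.

Section Symplectic.
Context {R : realType} {K : hilbertType R}.

Definition J (f : hsum K K) : hsum K K := (f.2, - f.1).

Definition omega (f g : hsum K K) : R[i] := hdot (J f) g.

Definition lagrangian (F : set (hsum K K)) : Prop :=
  F = [set f | forall g, F g -> omega f g = 0].

End Symplectic.

Section Traces.
Context {R : realType} {H K : hilbertType R} {D : completeNormedModType R[i]}.

(* The subspace [D] of [H] with its own Banach norm is a Banach space together
   with an injective linear map [iota : D -> H]; [lift iota] views a vector of
   [iota D] as an element of [D]. *)
Definition lift (iota : D -> H) (u : H) : D := xget 0 [set d | iota d = u].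

Definition resolventD (iota : D -> H) (A : operator H) (z : R[i]) : H -> D :=
  lift iota \o resolvent A z.

(* The coefficient of [t - t0] in the expansion of the resolvent of [B] at [z],
   where [V'], [Q'], [T'] are derivatives of potential, projection and trace. *)
Definition resolvent_variation (iota : D -> H) (T : D -> hsum K K)
    (B : operator H) (V' : H -> H) (Q' : hsum K K -> hsum K K)
    (T' : D -> hsum K K) (z : R[i]) : H -> H :=
  let Rz := resolvent B z in
  let RDz := resolventD iota B z in
  let TRadj := bounded_adjoint (T \o resolventD iota B z^*%C) in
  fun f => - Rz (V' (Rz f)) + TRadj (Q' (J (T (RDz f))))
           + TRadj (J (T' (RDz f))).

End Traces.

Section ResolventFamily.
Context {R : realType} {H : hilbertType R}.

Definition nbhd_box (t0 : R) (z0 : R[i]) (eps : R) : set (R * R[i]) :=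
  [set p | [/\ 0 <= p.1 <= 1, `|p.1 - t0| <= eps & `|p.2 - z0| <= eps%:C]].

(* The box around [(t0, z0)] avoids the spectra, and [t |-> (B t - z)^-1] is
   continuous at [t0] uniformly in [z]. *)
Definition stable_resolvent (B : R -> operator H) (t0 : R) (z0 : R[i])
    (eps : R) : Prop :=
  (forall t z, nbhd_box t0 z0 eps (t, z) -> ~ spectrum (B t) z) /\
  (forall e : R, 0 < e -> \forall t \near at01 t0,
     forall z, `|z - z0| < eps%:C ->
       (opnorm (resolvent (B t) z \- resolvent (B t0) z) <= e%:E)%E).

End ResolventFamily.

(* Main.v *)
(* Let x = R_t(z) f and y = R_0(conj z) g.  Green's formula for T_0 gives
     <(R_t - R_0) f, g> = <J (T_t - T_0) x, T_0 y> + <(Q_t - Q_0) J T_t x, T_0 y>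
                          - <(V_t - V_0) x, y>,
   because T_0 y = Q_0 T_0 y, T_t x = Q_t T_t x and Q_t J Q_t = 0 for a Lagrangian
   range.  All three differences are small and T_0 R_0(conj z) is bounded by the
   closed graph theorem, which yields continuity and the Lipschitz bound; the same
   identity with differences replaced by their first order parts, together with
   R_t(z) -> R_0(z) in B(H, D), yields the expansion.  The same formula tested
   against y = R_0(conj z0) x bounds H_t - z from below near (t0, z0), so z is in the
   resolvent set of the self-adjoint operator H_t. *)

Require Import Defs.
From mathcomp Require Import all_boot all_order all_algebra.
From mathcomp Require Import complex.
From mathcomp Require Import all_classical all_reals all_analysis.
From mathcomp Require Import ring lra.

Set Implicit Arguments.
Unset Strict Implicit.
Unset Printing Implicit Defensive.

Import Order.TTheory GRing.Theory Num.Theory.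
Import numFieldNormedType.Exports.

Local Open Scope classical_set_scope.
Local Open Scope ring_scope.
Local Open Scope complex_scope.

(** * Real-valued norms and inner products *)

Section RealNorm.
Context {R : realType}.

(** The domains of [H_t] vary with [t] and the traces are bounded in the norm of [D], so resolvents
    are compared through the sesquilinear form of Green's formula, whose bounds come out in norms of
    [D]. The way back to [H] is x = (A_t - i)^{-1} ((H_t - z) x + (z - i) x - V_t x): it turns the
    assumed bound on (A_t - i)^{-1} in B(H, D) into a bound of the [D]-norm by the graph norm of
    [H_t], with a constant independent of [t]. The difference of this identity at two parameters
    upgrades convergence of resolvents from B(H) to B(H, D). A lower bound for H_t - z is enough for
    [z] to be in the resolvent set: <H_t u, u> is real, so the same bound holds at conj z and kills
    the orthogonal complement of the range. A single modulus [d] measures the distance of traces,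
    potentials and projections, and estimates explicit in [d] serve all three statements. The limits
    are punctured at [t0], so [t0] itself is treated apart. *)

Lemma realC_inj (a b : R) : a%:C = b%:C -> a = b.
Proof. by case. Qed.

Lemma realCD (a b : R) : (a + b)%:C = a%:C + b%:C. Proof. exact: rmorphD. Qed.
Lemma realCB (a b : R) : (a - b)%:C = a%:C - b%:C. Proof. exact: rmorphB. Qed.
Lemma realCM (a b : R) : (a * b)%:C = a%:C * b%:C. Proof. exact: rmorphM. Qed.
Lemma realCX (a : R) n : (a ^+ n)%:C = a%:C ^+ n. Proof. exact: rmorphXn. Qed.

Section Normed.
Context {V : normedZmodType R[i]}.
Implicit Types x y : V.

(* Norms of modules over [R[i]] lie in [R[i]]; [nrm] reads them in [R]. *)
Definition nrm x : R := complex.Re `|x|.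

Lemma nrmE x : `|x| = (nrm x)%:C.
Proof. by rewrite /nrm RRe_real // normr_real. Qed.

Lemma nrm_ge0 x : 0 <= nrm x.
Proof. by have := normr_ge0 x; rewrite nrmE lecR. Qed.

Lemma nrmD x y : nrm (x + y) <= nrm x + nrm y.
Proof. by have := ler_normD x y; rewrite !nrmE -realCD lecR. Qed.

Lemma nrmN x : nrm (- x) = nrm x.
Proof. by rewrite /nrm normrN. Qed.

Lemma nrmB x y : nrm (x - y) <= nrm x + nrm y.
Proof. by rewrite -(nrmN y) nrmD. Qed.

Lemma nrm_distC x y : nrm (x - y) = nrm (y - x).
Proof. by rewrite -nrmN opprB. Qed.

Lemma nrm0 : nrm (0 : V) = 0.
Proof. by rewrite /nrm normr0. Qed.

Lemma nrm_eq0 x : nrm x = 0 -> x = 0.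
Proof. by move=> x0; apply/normr0_eq0; rewrite nrmE x0. Qed.

Lemma nrm_dist_triangle z x y : nrm (x - y) <= nrm (x - z) + nrm (z - y).
Proof. by rewrite (_ : x - y = (x - z) + (z - y)) ?nrmD // addrA subrK. Qed.

End Normed.

Lemma nrm_real (r : R) : nrm (r%:C : R[i]) = `|r|.
Proof. by apply: realC_inj; rewrite -nrmE normc_def /= expr0n /= addr0 sqrtr_sqr. Qed.

Lemma nrmM (a b : R[i]) : nrm (a * b) = nrm a * nrm b.
Proof. by apply: realC_inj; rewrite realCM -!nrmE normrM. Qed.

Lemma nrmJ (a : R[i]) : nrm a^*%C = nrm a.
Proof. by apply: realC_inj; rewrite -!nrmE normcJ. Qed.

Lemma nrmi : nrm ('i : R[i]) = 1.
Proof. by apply: realC_inj; rewrite -nrmE normc_def /= expr0n /= add0r expr1n sqrtr1. Qed.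

Lemma sqr_nrmC (a : R[i]) : (nrm a ^+ 2)%:C = a * a^*%C.
Proof. by rewrite realCX -nrmE sqr_normc. Qed.

Section Complete.

(** Real tolerances and real norms keep the later limit arguments inside linear arithmetic over
    [R]. *)
Definition cvs {V : normedZmodType R[i]} (u : nat -> V) (l : V) :=
  forall e : R, 0 < e -> exists N, forall n, (N <= n)%N -> nrm (u n - l) < e.

Lemma cvs_unique {V : normedZmodType R[i]} (u : nat -> V) l l' :
  cvs u l -> cvs u l' -> l = l'.
Proof.
move=> ul ul'; apply/subr0_eq/nrm_eq0/eqP; rewrite eq_le nrm_ge0 andbT.
apply/ler_addgt0Pl => e e0; rewrite addr0.
have e20 : 0 < e / 2 by rewrite divr_gt0.
have [N hN] := ul _ e20; have [N' hN'] := ul' _ e20.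
have h1 := hN (maxn N N') (leq_maxl _ _); have h2 := hN' (maxn N N') (leq_maxr _ _).
have := nrm_dist_triangle (u (maxn N N')) l l'.
rewrite (nrm_distC l (u _)); lra.
Qed.

Lemma nrm_complete {V : completeNormedModType R[i]} (u : nat -> V) :
  (forall e : R, 0 < e -> exists N, forall n, (N <= n)%N -> nrm (u n - u N) < e) ->
  exists l, cvs u l.
Proof.
move=> uC.
have : cvg (u @ \oo).
  apply: cauchy_cvg; apply: cauchy_exP => e e0.
  (* A positive element of [R[i]] has zero imaginary part, so the tolerance can be read in [R]. *)
  have [r0 er] : 0 < complex.Re e /\ e = (complex.Re e)%:C.
    by rewrite RRe_real ?gtr0_real //; split => //; move: e0; rewrite ltcE => /andP[].
  have [N hN] := uC _ r0; exists (u N); exists N => // n /= Nn.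
  by rewrite -ball_normE /= er nrmE ltcR nrm_distC hN.
move=> /cvg_ex[l ul]; exists l => e e0.
have ec0 : 0 < e%:C by rewrite ltcR.
have /cvgrPdist_lt/(_ _ ec0)[N _ hN] := ul.
by exists N => n Nn; have := hN n Nn; rewrite /= nrmE ltcR nrm_distC.
Qed.

End Complete.

Section Module.
Context {V : normedModType R[i]}.

Lemma nrmZ (a : R[i]) (x : V) : nrm (a *: x) = nrm a * nrm x.
Proof. by apply: realC_inj; rewrite realCM -!nrmE normrZ. Qed.

Lemma nrmZr (r : R) (x : V) : nrm (r%:C *: x) = `|r| * nrm x.
Proof. by rewrite nrmZ nrm_real. Qed.

Lemma dense_nrm (S : set V) (x : V) (e : R) :
  dense S -> 0 < e -> exists2 s, S s & nrm (x - s) < e.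
Proof.
move=> dS e0.
have ec0 : 0 < e%:C by rewrite ltcR.
have [|s [/= xs Ss]] := dS (ball x e%:C) _ (ball_open x e%:C).
  by exists x; apply: ballxx.
by exists s => //; move: xs; rewrite -ball_normE /= nrmE ltcR.
Qed.

End Module.

Section Dot.
Context {H : hilbertType R}.
Implicit Types x y z : H.

Lemma dotC x y : hdot x y = (hdot y x)^*%C.
Proof. by rewrite (hermC hdot) expr0 mul1r. Qed.

Lemma dotDl x y z : hdot (x + y) z = hdot x z + hdot y z.
Proof. exact: linearDl. Qed.

Lemma dotDr x y z : hdot z (x + y) = hdot z x + hdot z y.
Proof. exact: linearDr. Qed.

Lemma dotBl x y z : hdot (x - y) z = hdot x z - hdot y z.
Proof. exact: linearBl. Qed.

Lemma dotBr x y z : hdot z (x - y) = hdot z x - hdot z y.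
Proof. exact: linearBr. Qed.

Lemma dotNl x z : hdot (- x) z = - hdot x z.
Proof. exact: linearNl. Qed.

Lemma dotNr x z : hdot z (- x) = - hdot z x.
Proof. exact: linearNr. Qed.

Lemma dotZl (a : R[i]) x y : hdot (a *: x) y = a * hdot x y.
Proof. exact: linearZl_LR. Qed.

Lemma dotZr (a : R[i]) x y : hdot x (a *: y) = a^*%C * hdot x y.
Proof. exact: linearZr_LR. Qed.

Lemma dot0l x : hdot 0 x = 0. Proof. exact: linear0l. Qed.
Lemma dot0r x : hdot x 0 = 0. Proof. exact: linear0r. Qed.

Lemma dot_nrm x : hdot x x = (nrm x ^+ 2)%:C.
Proof. by rewrite -hdot_norm nrmE realCX. Qed.

Lemma nrm_sqrD x y :
  nrm (x + y) ^+ 2 = nrm x ^+ 2 + nrm y ^+ 2 + 2 * complex.Re (hdot x y).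
Proof.
apply: realC_inj.
rewrite realCD (realCM 2) (realCD (_ ^+ 2)) -!dot_nrm dotDl !dotDr (dotC y x).
have -> : (2 : R)%:C = 2%:R by rewrite -[LHS]/(2%:R%:C) [LHS]rmorph_nat.
by rewrite -addcJ; ring.
Qed.

Lemma parallelogram x y :
  nrm (x + y) ^+ 2 + nrm (x - y) ^+ 2 = 2 * nrm x ^+ 2 + 2 * nrm y ^+ 2.
Proof. by rewrite !nrm_sqrD dotNr nrmN raddfN /=; ring. Qed.

Lemma cauchy_schwarz x y : nrm (hdot x y) <= nrm x * nrm y.
Proof.
have [x0|x0] := eqVneq (nrm x) 0.
  by rewrite (nrm_eq0 x0) dot0l !nrm0 mul0r.
have xp : 0 < nrm x by rewrite lt_def x0 nrm_ge0.
set a := hdot y x.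
have ax : nrm a = nrm (hdot x y) by rewrite /a dotC nrmJ.
(* The component of [y] orthogonal to [x], scaled by |x|^2 so that nothing is divided. *)
pose z := (nrm x ^+ 2)%:C *: y - a *: x.
have : (nrm z ^+ 2) = nrm x ^+ 2 * (nrm x ^+ 2 * nrm y ^+ 2 - nrm a ^+ 2).
  apply: realC_inj; rewrite -dot_nrm /z dotBl !dotBr !dotZl !dotZr conjc_real.
  rewrite !dot_nrm -/a (dotC x y) -/a (realCM (_ ^+ 2)) (realCB (_ * _)).
  by rewrite (realCM (_ ^+ 2) (_ ^+ 2)) (sqr_nrmC a); ring.
move=> zE.
have : 0 <= nrm x ^+ 2 * (nrm x ^+ 2 * nrm y ^+ 2 - nrm a ^+ 2).
  by rewrite -zE sqr_ge0.
rewrite pmulr_rge0 ?exprn_gt0 // subr_ge0 -exprMn ax.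
by rewrite ler_pXn2r ?nnegrE ?nrm_ge0 ?mulr_ge0 ?nrm_ge0.
Qed.

(** Test against [x] itself. This duality turns the form estimates from Green's formula into
    operator bounds. *)
Lemma nrm_le_dot x (M : R) : 0 <= M ->
  (forall y, nrm (hdot x y) <= M * nrm y) -> nrm x <= M.
Proof.
move=> M0 h; have [->|x0] := eqVneq x 0; first by rewrite nrm0.
have xp : 0 < nrm x.
  by rewrite lt_def nrm_ge0 andbT; apply: contra_neq x0; exact: nrm_eq0.
have := h x; rewrite dot_nrm nrm_real ger0_norm ?sqr_ge0 // expr2.
by rewrite ler_pM2r.
Qed.

End Dot.

End RealNorm.

(** * Bounded operators and the closed graph theorem *)

Section BoundedOperators.
Context {R : realType}.

Lemma exp_half_lt (e : R) : 0 < e ->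
  exists N, forall n, (N <= n)%N -> (2^-1 : R) ^+ n < e.
Proof.
move=> e0; exists (Num.truncn e^-1).+1 => n Nn.
rewrite exprVn -ltf_pV2 ?posrE ?invr_gt0 ?exprn_gt0 // invrK.
apply: (lt_le_trans (truncnS_gt _)).
rewrite -natrX ler_nat (leq_trans Nn) //; apply: ltnW; exact: ltn_expl.
Qed.

Section OpNorm.
Context {U V : normedModType R[i]}.
Implicit Types f g : U -> V.

(** For linear [f] and [0 <= M] this is [opnorm f <= M], but as a real inequality on vectors, free
    of extended reals. *)
Definition opbd f (M : R) := forall x, nrm (f x) <= M * nrm x.

Lemma opbd_le f (M M' : R) : M <= M' -> opbd f M -> opbd f M'.
Proof.
by move=> MM' fM x; apply: (le_trans (fM x)); rewrite ler_wpM2r ?nrm_ge0.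
Qed.

Lemma linearP_D f : linear f -> {morph f : x y / x + y}.
Proof. by move=> fl x y; have := fl 1 x y; rewrite !scale1r. Qed.

Lemma linearP_0 f : linear f -> f 0 = 0.
Proof.
by move=> fl; apply: (addrI (f 0)); rewrite -linearP_D // !addr0.
Qed.

Lemma linearP_Z f : linear f -> forall a x, f (a *: x) = a *: f x.
Proof. by move=> fl a x; have := fl a x 0; rewrite !addr0 linearP_0 // addr0. Qed.

Lemma linearP_B f : linear f -> {morph f : x y / x - y}.
Proof. by move=> fl x y; rewrite linearP_D // -[- y]scaleN1r linearP_Z // scaleN1r. Qed.

Lemma opnorm_le f (M : R) : 0 <= M -> opbd f M -> (opnorm f <= M%:E)%E.
Proof.
move=> M0 fM; apply: ub_ereal_sup => _ [x /= x1 <-]; rewrite lee_fin.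
rewrite -/(nrm (f x)); apply: (le_trans (fM x)).
by rewrite -[leRHS]mulr1 ler_wpM2l // -lecR -nrmE.
Qed.

Lemma opbd_opnorm f (M : R) : linear f -> (opnorm f <= M%:E)%E -> opbd f M.
Proof.
move=> fl fM x; have [->|x0] := eqVneq x 0.
  by rewrite linearP_0 // !nrm0 mulr0.
have xp : 0 < nrm x.
  by rewrite lt_def nrm_ge0 andbT; apply: contra_neq x0; exact: nrm_eq0.
rewrite -ler_pdivrMr // mulrC.
have -> : (nrm x)^-1 * nrm (f x) = nrm (f ((nrm x)^-1%:C *: x)).
  by rewrite linearP_Z // nrmZr ger0_norm ?invr_ge0 ?ltW.
rewrite -lee_fin; apply: le_trans fM; apply: ereal_sup_ubound.
exists ((nrm x)^-1%:C *: x) => //=.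
by rewrite nrmE (_ : 1 = 1%:C) // lecR nrmZr ger0_norm ?invr_ge0 ?(ltW xp) // mulVf ?gt_eqF.
Qed.

Lemma opnorm_ge0 f : (0 <= opnorm f)%E.
Proof.
apply: (@le_trans _ _ (nrm (f 0))%:E); first by rewrite lee_fin nrm_ge0.
by apply: ereal_sup_ubound; exists 0 => //=; rewrite normr0.
Qed.

Lemma opbd_bounded_op f (M : R) : linear f -> 0 <= M -> opbd f M -> bounded_op f.
Proof.
by move=> fl M0 fM; split=> //; apply: le_lt_trans (opnorm_le M0 fM) (ltry _).
Qed.

Lemma bounded_op_opbd f : bounded_op f -> exists2 M, 0 <= M & opbd f M.
Proof.
move=> [fl f_fin]; have f0 := opnorm_ge0 f.
have fin : opnorm f \is a fin_num by rewrite ge0_fin_numE.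
exists (fine (opnorm f)); first exact: fine_ge0.
by apply: opbd_opnorm => //; rewrite fineK.
Qed.

Lemma opbd_cvs f (M : R) (u : nat -> U) l :
  linear f -> opbd f M -> cvs u l -> cvs (f \o u) (f l).
Proof.
move=> fl fM ul e e0.
have M1 : 0 < `|M| + 1 by rewrite ltr_wpDl.
have [|N hN] := ul (e / (`|M| + 1)); first by rewrite divr_gt0.
exists N => n /hN; rewrite /= -linearP_B // ltr_pdivlMr // mulrC.
apply: le_lt_trans; apply: (le_trans (fM _)).
by rewrite ler_wpM2r ?nrm_ge0 // (le_trans (ler_norm _)) // lerDl.
Qed.

End OpNorm.

Lemma opbd_comp {U V W : normedModType R[i]} (g : V -> W) (f : U -> V) (M N : R) :
  0 <= M -> opbd g M -> opbd f N -> opbd (g \o f) (M * N).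
Proof.
move=> M0 gM fN x; apply: (le_trans (gM _)).
by rewrite -mulrA ler_wpM2l.
Qed.

Section BoundedOp.
Context {U V W : normedModType R[i]}.

Lemma bounded_op_comp (g : V -> W) (f : U -> V) :
  bounded_op g -> bounded_op f -> bounded_op (g \o f).
Proof.
move=> bg bf; have [M M0 gM] := bounded_op_opbd bg.
have [N N0 fN] := bounded_op_opbd bf.
apply: opbd_bounded_op (mulr_ge0 M0 N0) (opbd_comp M0 gM fN).
by move=> a x y /=; rewrite bf.1 bg.1.
Qed.

Lemma bounded_op_add (f g : U -> V) :
  bounded_op f -> bounded_op g -> bounded_op (fun x => f x + g x).
Proof.
move=> bf bg; have [M M0 fM] := bounded_op_opbd bf.
have [N N0 gN] := bounded_op_opbd bg.
apply: (@opbd_bounded_op _ _ _ (M + N)); last 2 first.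
- by rewrite addr_ge0.
- move=> x; rewrite mulrDl; apply: (le_trans (nrmD _ _)).
  by apply: lerD; [exact: fM | exact: gN].
by move=> a x y; rewrite bf.1 bg.1 scalerDr addrACA.
Qed.

Lemma bounded_op_opp (f : U -> V) : bounded_op f -> bounded_op (fun x => - f x).
Proof.
move=> bf; have [M M0 fM] := bounded_op_opbd bf.
apply: (@opbd_bounded_op _ _ _ M) => //; last by move=> x; rewrite nrmN; exact: fM.
by move=> a x y; rewrite bf.1 opprD scalerN.
Qed.

End BoundedOp.

(** * The closed graph theorem *)

Section ClosedGraph.
Context {U V : completeNormedModType R[i]}.
Variable S : U -> V.
Hypothesis S_lin : linear S.
Hypothesis S_closed : forall u l m, cvs u l -> cvs (S \o u) m -> S l = m.

(* Baire's argument with nested balls: were every sublevel set of [nrm \o S]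
   nowhere dense, the limit of the centers would have infinite [nrm (S _)]. *)
Let sublevel_somewhere_dense : exists (M : R) (x0 : U) (r : R), [/\ 0 <= M, 0 < r &
  forall x, nrm (x - x0) <= r ->
    forall e, 0 < e -> exists2 y, nrm (x - y) < e & nrm (S y) <= M].
Proof.
apply: contrapT => neg.
(* With [p] = (n, (centre, radius)), shrink to a closed ball inside the given one on which
   [nrm (S y)] exceeds [n]. Putting positivity of the radius as a premise makes the relation total,
   as [choice] requires. *)
have step (p : nat * (U * R)) : exists q : U * R, 0 < p.2.2 ->
    [/\ 0 < q.2, q.2 <= (2^-1) ^+ p.1.+1,
        forall y, nrm (y - q.1) <= q.2 -> nrm (y - p.2.1) <= p.2.2 &
        forall y, nrm (y - q.1) <= q.2 -> p.1%:R < nrm (S y)].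
  case: p => n [x0 r] /=.
  have [r0|r0] := ltP 0 r; last by exists (x0, r).
  have r20 : 0 < r / 2 by rewrite divr_gt0.
  have [x [e [xr e0 he]]] : exists x e, [/\ nrm (x - x0) <= r / 2, 0 < e &
      forall y, nrm (x - y) < e -> n%:R < nrm (S y)].
    apply: contrapT => neg'; apply: neg; exists n%:R, x0, (r / 2); split=> //.
    move=> x xr e e0; apply: contrapT => neg''; apply: neg'.
    exists x, e; split=> // y xy; rewrite ltNge; apply/negP => Sy.
    by apply: neg''; exists y.
  pose q := Num.min (Num.min (e / 2) (r / 2)) ((2^-1) ^+ n.+1).
  have qe : q <= e / 2 by rewrite /q !ge_min lexx.
  have qr : q <= r / 2 by rewrite /q !ge_min lexx orbT.
  have qh : q <= (2^-1) ^+ n.+1 by rewrite /q ge_min lexx orbT.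
  have q0 : 0 < q by rewrite /q !lt_min r20 divr_gt0 // exprn_gt0.
  exists (x, q) => _ /=; split=> // y yx.
    by have := nrm_dist_triangle x y x0; lra.
  by apply: he; rewrite nrm_distC; lra.
have [g gP] := choice step.
pose a := fix a n := if n is m.+1 then g (m, a m) else (0 : U, 1 : R).
have a0 n : 0 < (a n).2.
  elim: n => [|n IH] //=; by have [] := gP (n, a n) IH.
have aS n := gP (n, a n) (a0 n).
have nested n m : (n <= m)%N -> nrm ((a m).1 - (a n).1) <= (a n).2.
  move=> nm; rewrite -(subnK nm); move: (m - n)%N => k {nm m}.
  suff : forall y, nrm (y - (a (k + n)%N).1) <= (a (k + n)%N).2 ->
      nrm (y - (a n).1) <= (a n).2.
    by apply; rewrite subrr nrm0 ltW.
  elim: k => [|k IH] y //= yk; apply: IH.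
  by have [_ _ h _] := aS (k + n)%N; apply: h.
have [l al] : exists l, cvs (fun n => (a n).1) l.
  apply: nrm_complete => e e0; have [N hN] := exp_half_lt e0.
  exists N.+1 => n Nn; apply: (le_lt_trans (nested _ _ Nn)).
  by have [_ h _ _] := aS N; apply: (le_lt_trans h); apply: hN.
have lball n : nrm (l - (a n).1) <= (a n).2.
  apply/ler_addgt0Pl => e e0; have [N hN] := al _ e0.
  have h1 := hN (maxn N n) (leq_maxl _ _).
  have h2 := nested n (maxn N n) (leq_maxr _ _).
  have := nrm_dist_triangle (a (maxn N n)).1 l (a n).1.
  rewrite (nrm_distC l (a (maxn N n)).1); lra.
(* The ball of index [n.+1] was built to force [nrm (S y) > n]; it contains [l], although [n]
   already exceeds [nrm (S l)]. *)
pose n := (Num.truncn (nrm (S l))).+1.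
have [_ _ _ /(_ l (lball n.+1)) /=] := aS n.
by apply/negP; rewrite -leNgt; apply: ltW (truncnS_gt _).
Qed.

(** Differences of points from the ball where the sublevel set is dense give density of the level
    [2 * M] in the ball of radius [r] about 0; homogeneity then yields [c = 2 * M / r]. *)
Let approx : exists2 c : R, 0 <= c & forall x e, 0 < e ->
  exists2 y, nrm (x - y) < e & nrm (S y) <= c * nrm x.
Proof.
have [M [x0 [r [M0 r0 h]]]] := sublevel_somewhere_dense.
have h' x : nrm x <= r -> forall e, 0 < e ->
    exists2 y, nrm (x - y) < e & nrm (S y) <= 2 * M.
  move=> xr e e0; have e20 : 0 < e / 2 by rewrite divr_gt0.
  have [|y1 xy1 Sy1] := h (x0 + x) _ _ e20; first by rewrite addrC addKr.
  have [|y2 xy2 Sy2] := h x0 _ _ e20; first by rewrite subrr nrm0 ltW.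
  exists (y1 - y2); last first.
    by rewrite linearP_B //; have := nrmB (S y1) (S y2); lra.
  have -> : x - (y1 - y2) = (x0 + x - y1) - (x0 - y2).
    by rewrite !opprB (addrC x0 x) !addrA [RHS](ACl (1*4*3*2*5)) /= addrK.
  by have := nrmB (x0 + x - y1) (x0 - y2); lra.
exists (2 * M / r) => [|x e e0]; first by rewrite divr_ge0 ?mulr_ge0 // ltW.
have [->|x_neq0] := eqVneq x 0.
  by exists 0; rewrite ?subrr ?linearP_0 // !nrm0 ?mulr0.
have xp : 0 < nrm x.
  by rewrite lt_def nrm_ge0 andbT; apply: contra_neq x_neq0; exact: nrm_eq0.
pose t := r / nrm x.
have t0 : 0 < t by rewrite divr_gt0.
have te0 : 0 < t * e by rewrite mulr_gt0.
have [|y xy Sy] := h' (t%:C *: x) _ _ te0.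
  by rewrite nrmZr gtr0_norm // /t divfK ?gt_eqF.
exists (t^-1%:C *: y).
    have -> : x - t^-1%:C *: y = t^-1%:C *: (t%:C *: x - y).
      by rewrite scalerBr scalerA -realCM mulVf ?scale1r ?gt_eqF.
    by rewrite nrmZr gtr0_norm ?invr_gt0 // -ltr_pdivlMl ?invr_gt0 // invrK.
  rewrite linearP_Z // nrmZr gtr0_norm ?invr_gt0 //.
  have -> : 2 * M / r * nrm x = t^-1 * (2 * M).
    by rewrite /t invf_div; field; rewrite gt_eqF.
  by rewrite ler_wpM2l // invr_ge0 ltW.
Qed.

(** Successive approximation: each residual is approximated within half of the previous error by a
    vector whose image is at most [c] times the residual. The images of the partial sums are Cauchy
    with total at most 2 c |x|, and closedness identifies their limit with [S x]. *)
Theorem closed_graph : exists2 M : R, 0 <= M & opbd S M.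
Proof.
have [c c0 happ] := approx.
have pick (p : U * R) : exists y, 0 < p.2 ->
    nrm (p.1 - y) < p.2 /\ nrm (S y) <= c * nrm p.1.
  case: p => x e /=; have [e0|e0] := ltP 0 e; last by exists 0.
  by have [y] := happ x e e0; exists y.
have [g gP] := choice pick.
exists (2 * c) => [|x]; first by rewrite mulr_ge0.
have [->|x_neq0] := eqVneq x 0; first by rewrite linearP_0 // !nrm0 mulr0.
have xp : 0 < nrm x.
  by rewrite lt_def nrm_ge0 andbT; apply: contra_neq x_neq0; exact: nrm_eq0.
pose e n := nrm x * 2^-1 ^+ n.
have e0 n : 0 < e n by rewrite mulr_gt0 // exprn_gt0.
(* [xs n] is the residual after [n] corrections, so [x - xs n] is the partial sum. *)
pose xs := fix xs n := if n is m.+1 then xs m - g (xs m, e m.+1) else x.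
have xsS n : xs n.+1 = xs n - g (xs n, e n.+1) by [].
have xs_le n : nrm (xs n) <= e n.
  case: n => [|n]; first by rewrite /e expr0 mulr1.
  by have [/ltW] := gP (xs n, e n.+1) (e0 _).
(* Since c e_m = 2 c (e_m - e_{m+1}), the bound telescopes. *)
have Sdiff n k : nrm (S (x - xs (k + n)%N) - S (x - xs n)) <= 2 * c * (e n - e (k + n)%N).
  elim: k => [|k IH]; first by rewrite !subrr nrm0 mulr0.
  apply: (le_trans (nrm_dist_triangle (S (x - xs (k + n)%N)) _ _)).
  rewrite addSn -linearP_B // xsS.
  have -> : x - (xs (k + n)%N - g (xs (k + n)%N, e (k + n).+1)) - (x - xs (k + n)%N) =
      g (xs (k + n)%N, e (k + n).+1).
    by rewrite !opprB !addrA [LHS](ACl (1*5*4*3*2)) /= subrr add0r subrr add0r.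
  have [_ /= h] := gP (xs (k + n)%N, e (k + n).+1) (e0 _).
  have h2 : c * nrm (xs (k + n)%N) <= c * e (k + n)%N by rewrite ler_wpM2l.
  have h3 : e (k + n).+1 = e (k + n)%N / 2 by rewrite /e exprSr mulrA.
  rewrite h3; move: h h2 IH; rewrite h3.
  set A := nrm _; set B := c * nrm _; set C := nrm _; lra.
have Sle n k : nrm (S (x - xs (k + n)%N) - S (x - xs n)) <= 2 * c * e n.
  apply: (le_trans (Sdiff n k)); rewrite ler_wpM2l ?mulr_ge0 //.
  by rewrite lerBlDr lerDl ltW.
have esmall (d : R) : 0 < d -> exists N, forall n, (N <= n)%N -> e n < d.
  move=> d0; have [|N hN] := @exp_half_lt (d / nrm x); first by rewrite divr_gt0.
  by exists N => n /hN; rewrite ltr_pdivlMr // mulrC.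
have xscvs : cvs (fun n => x - xs n) x.
  move=> d d0; have [N hN] := esmall d d0; exists N => n Nn.
  by rewrite nrm_distC opprB addrC subrK; apply: (le_lt_trans (xs_le n)); apply: hN.
have [m Sm] : exists m, cvs (S \o (fun n => x - xs n)) m.
  apply: nrm_complete => d d0.
  have [|N hN] := esmall (d / (2 * c + 1)).
    by rewrite divr_gt0 // ltr_wpDl // mulr_ge0.
  exists N => n Nn; rewrite /= -(subnK Nn).
  apply: (le_lt_trans (Sle _ _)).
  have := hN N (leqnn _); rewrite ltr_pdivlMr ?ltr_wpDl ?mulr_ge0 //.
  have := e0 N; lra.
rewrite (S_closed xscvs Sm); apply/ler_addgt0Pl => d d0.
have [N hN] := Sm _ d0; have {hN} := hN N (leqnn _).
have := Sle 0%N N; rewrite addn0 /= subrr (linearP_0 S_lin) subr0 /e expr0 mulr1.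
have := nrm_dist_triangle (S (x - xs N)) m 0; rewrite !subr0.
rewrite (nrm_distC m); lra.
Qed.

End ClosedGraph.

End BoundedOperators.

(** * Orthogonal projections, adjoints and resolvents *)

Section HilbertSpace.
Context {R : realType}.

Lemma conjcZ (r : R) (c : R[i]) : (r%:C * c)^*%C = r%:C * c^*%C.
Proof.
case: c => a b; apply/eqP; rewrite eq_complex /=.
by apply/andP; split; apply/eqP; ring.
Qed.

(** * Orthogonal decomposition along a closed subspace *)

Section Projection.
Context {H : hilbertType R}.
Implicit Types x y z : H.

Lemma nrm_gt0 x : (0 < nrm x) = (x != 0).
Proof.
rewrite lt_def nrm_ge0 andbT; congr (~~ _).
by apply/eqP/eqP => [/nrm_eq0 //|->]; rewrite nrm0.
Qed.

Lemma dotr_inj x y : (forall z, hdot z x = hdot z y) -> x = y.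
Proof.
move=> h; apply/subr0_eq/nrm_eq0/eqP; rewrite -sqrf_eq0; apply/eqP/realC_inj.
by rewrite -dot_nrm dotBr h subrr.
Qed.

Lemma cvs_dotl (u : nat -> H) l v :
  cvs u l -> cvs (fun n => hdot (u n) v) (hdot l v).
Proof.
move=> ul e e0; have v1 : 0 < nrm v + 1 by rewrite ltr_wpDl ?nrm_ge0.
have [|N hN] := ul (e / (nrm v + 1)); first by rewrite divr_gt0.
exists N => n /hN; rewrite -dotBl ltr_pdivlMr //; apply: le_lt_trans.
apply: (le_trans (cauchy_schwarz _ _)).
by rewrite ler_wpM2l ?nrm_ge0 // lerDl.
Qed.

Lemma cvs_dotr (u : nat -> H) l v :
  cvs u l -> cvs (fun n => hdot v (u n)) (hdot v l).
Proof.
move=> ul e e0; have [N hN] := cvs_dotl v ul e0.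
by exists N => n /hN; rewrite (dotC v) (dotC v l) -rmorphB nrmJ.
Qed.

(** If [x] were nonzero, some [s] in [S] would lie closer to [x] than |x|, and |x|^2 = <x - s, x>
    would be less than |x|^2. *)
Lemma dense_orthogonal (S : set H) x :
  dense S -> (forall y, S y -> hdot y x = 0) -> x = 0.
Proof.
move=> dS h; apply: contrapT => /eqP; rewrite -nrm_gt0 => x0.
have [s Ss xs] := dense_nrm x dS x0.
have := cauchy_schwarz (x - s) x.
rewrite dotBl (h _ Ss) subr0 dot_nrm nrm_real ger0_norm ?sqr_ge0 // expr2.
by rewrite leNgt ltr_pM2r ?xs.
Qed.

(** The optimal [a] = <x, y> / |y|^2 lowers |x|^2 by |<x, y>|^2 / |y|^2, and near-minimality caps
    this drop by [e]. The quantitative form applies along a minimizing sequence. *)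
Lemma near_minimizer (d e : R) x y : 0 <= e ->
  nrm x ^+ 2 <= d + e -> (forall a, d <= nrm (x - a *: y) ^+ 2) ->
  nrm (hdot x y) ^+ 2 <= e * nrm y ^+ 2.
Proof.
move=> e0 xde min; have [->|y0] := eqVneq y 0.
  by rewrite dot0r !nrm0 expr0n mulr0.
rewrite -nrm_gt0 in y0.
have y2 : 0 < nrm y ^+ 2 by rewrite exprn_gt0.
pose s := (nrm y ^+ 2)^-1; pose c := hdot x y.
have := min (s%:C * c); rewrite nrm_sqrD nrmN nrmZ nrmM nrm_real.
have -> : complex.Re (hdot x (- (s%:C * c *: y))) = - (s * nrm c ^+ 2).
  rewrite dotNr dotZr conjcZ -mulrA [_^*%C * _]mulrC.
  by rewrite -/c -sqr_nrmC -realCM.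
rewrite ger0_norm ?invr_ge0 ?sqr_ge0 // !exprMn => h.
have sy : s * nrm y ^+ 2 = 1 by rewrite mulVf // gt_eqF.
have -> : nrm c ^+ 2 = s * nrm c ^+ 2 * nrm y ^+ 2 by rewrite mulrAC sy mul1r.
rewrite ler_pM2r //.
have h3 : s ^+ 2 * nrm c ^+ 2 * nrm y ^+ 2 = s * nrm c ^+ 2.
  by rewrite -[RHS]mul1r -sy; ring.
by move: h; rewrite h3; lra.
Qed.

(** A sequence minimizing the distance to [M] is Cauchy by the parallelogram law, because midpoints
    stay in [M]. Orthogonality is the limit of [near_minimizer] along it. *)
Theorem orthogonal_decomposition (M : set H) x :
  M 0 -> (forall a u v, M u -> M v -> M (a *: u + v)) ->
  (forall u l, (forall n, M (u n)) -> cvs u l -> M l) ->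
  exists2 m, M m & forall y, M y -> hdot (x - m) y = 0.
Proof.
move=> M0 M_lin M_closed.
pose E := [set nrm (x - y) ^+ 2 | y in M].
have E_inf : has_inf E.
  split; first by exists (nrm (x - 0) ^+ 2), 0.
  by exists 0 => _ [y _ <-]; apply: sqr_ge0.
pose d := inf E.
have dmin y : M y -> d <= nrm (x - y) ^+ 2.
  by move=> My; apply: ge_inf; [case: E_inf | exists y].
pose e n := (2^-1 : R) ^+ n.
have e0 n : 0 < e n by rewrite exprn_gt0.
have pick n : exists y, M y /\ nrm (x - y) ^+ 2 <= d + e n.
  have [_ [y My <-] /ltW h] := inf_adherent (e0 n) E_inf.
  by exists y; split => //.
have [u uP] := choice pick.
have Mu n : M (u n) by case: (uP n).
have du n : nrm (x - u n) ^+ 2 <= d + e n by case: (uP n).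
have udist n k : nrm (u n - u k) ^+ 2 <= 2 * e n + 2 * e k.
  have := parallelogram (x - u n) (x - u k).
  have -> : (x - u n) + (x - u k) = (2%:C) *: (x - 2^-1%:C *: (u n + u k)).
    rewrite scalerBr scalerA -realCM mulfV ?pnatr_eq0 // scale1r.
    rewrite -[(2 : R)%:C]/(2%:R%:C) [2%:R%:C]rmorph_nat scaler_nat mulr2n.
    by rewrite opprD addrACA.
  have -> : x - u n - (x - u k) = u k - u n by rewrite opprB addrC subrKA.
  rewrite nrmZr ger0_norm // exprMn (nrm_distC (u k)).
  have : M (2^-1%:C *: (u n + u k)).
    rewrite -[_ *: _]addr0; apply: (M_lin) => //.
    by rewrite -[u n]scale1r; apply: (M_lin).
  move=> /dmin; have := du n; have := du k; lra.
have [m um] : exists m, cvs u m.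
  apply: nrm_complete => c c0.
  (* Both errors below c^2 / 4 make [2 * e n + 2 * e N] less than c^2. *)
  have [|N hN] := @exp_half_lt R (c ^+ 2 / 4); first by rewrite divr_gt0 ?exprn_gt0.
  exists N => n Nn.
  rewrite -(@ltr_pXn2r _ 2) ?nnegrE ?nrm_ge0 ?(ltW c0) //.
  have := udist n N; have := hN _ Nn; have := hN _ (leqnn N); rewrite /e; lra.
exists m; first exact: M_closed um.
move=> y My; have hy n : nrm (hdot (x - u n) y) ^+ 2 <= e n * nrm y ^+ 2.
  apply: near_minimizer (du n) _; first exact: ltW.
  by move=> a; rewrite -addrA -opprD; apply: (dmin); rewrite addrC; apply: (M_lin).
have lim1 : cvs (fun n => hdot (x - u n) y) (hdot (x - m) y).
  apply: cvs_dotl => c c0; have [N hN] := um _ c0; exists N => n /hN h.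
  by rewrite nrm_distC opprB addrC subrKA.
apply: (cvs_unique lim1) => c c0; rewrite /=.
have y1 : 0 < nrm y ^+ 2 + 1 by rewrite ltr_wpDl ?sqr_ge0.
have [|N hN] := @exp_half_lt R (c ^+ 2 / (nrm y ^+ 2 + 1)).
  by rewrite divr_gt0 ?exprn_gt0.
exists N => n /hN; rewrite subr0 ltr_pdivlMr // => h.
rewrite -(@ltr_pXn2r _ 2) ?nnegrE ?nrm_ge0 ?(ltW c0) //.
apply: (le_lt_trans (hy n)); apply: le_lt_trans h.
by rewrite ler_wpM2l ?(ltW (e0 n)) // lerDl.
Qed.

End Projection.

(** * Riesz representation and bounded adjoints *)

Section BoundedAdjoint.
Context {H K : hilbertType R}.
Variables (S : H -> K) (M : R).
Hypotheses (S_lin : linear S) (M0 : 0 <= M) (S_bd : opbd S M).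

(** Riesz for the functional phi(u) = <S u, v>: with [z] orthogonal to its closed kernel [N], the
    vector phi(z) u - phi(u) z lies in [N] for every [u], so phi is a multiple of <u, z>. *)
Lemma bounded_adjoint_exists v : exists w, forall u, hdot (S u) v = hdot u w.
Proof.
pose N := [set u | hdot (S u) v = 0].
have [x0|] := pselect (forall x, N x).
  by exists 0 => u; rewrite dot0r x0.
move=> /existsNP[x /eqP Sx].
have [| | |m Nm mN] := @orthogonal_decomposition _ N x.
- by rewrite /N /= (linearP_0 S_lin) dot0l.
- move=> a u w Nu Nw; rewrite /N /= S_lin dotDl dotZl Nu Nw.
  by rewrite mulr0 addr0.
- move=> u l Nu ul; have lim1 := cvs_dotl v (opbd_cvs S_lin S_bd ul).
  apply: (cvs_unique lim1) => e e0; exists 0%N => n _ /=.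
  by rewrite Nu subrr nrm0.
pose z := x - m; pose phi u := hdot (S u) v.
have phiz : phi z = phi x by rewrite /phi /z (linearP_B S_lin) dotBl Nm subr0.
have z0 : 0 < nrm z.
  rewrite nrm_gt0; apply: contraNneq Sx => zz.
  by rewrite -[hdot _ _]/(phi x) -phiz /phi zz (linearP_0 S_lin) dot0l.
exists (((nrm z ^- 2)%:C * (phi z)^*%C) *: z) => u.
have : hdot (phi z *: u - phi u *: z) z = 0.
  rewrite dotC mN ?rmorph0 // /N /= (linearP_B S_lin) !(linearP_Z S_lin) dotBl !dotZl.
  by rewrite -/(phi u) -/(phi z) mulrC subrr.
rewrite dotBl !dotZl dot_nrm => /subr0_eq h.
rewrite dotZr conjcZ conjcK -mulrA h mulrCA -realCM.
by rewrite mulVf ?mulr1 // sqrf_eq0 gt_eqF.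
Qed.

Lemma bounded_adjointP u v : hdot (S u) v = hdot u (bounded_adjoint S v).
Proof.
have [w hw] := bounded_adjoint_exists v.
suff : adjoint_graph setT S v (bounded_adjoint S v) by apply.
by apply: xgetPex; exists w => u' _; exact: hw.
Qed.

Lemma bounded_adjoint_linear : linear (bounded_adjoint S).
Proof.
move=> a x y; apply: dotr_inj => z.
by rewrite dotDr dotZr -!bounded_adjointP dotDr dotZr.
Qed.

Lemma bounded_adjoint_opbd : opbd (bounded_adjoint S) M.
Proof.
move=> v; apply: nrm_le_dot; first by rewrite mulr_ge0 ?nrm_ge0.
move=> y; rewrite dotC nrmJ -bounded_adjointP.
apply: (le_trans (cauchy_schwarz _ _)).
by rewrite mulrAC ler_wpM2r ?nrm_ge0.
Qed.

End BoundedAdjoint.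

(** * Self-adjoint operators and their resolvents *)

Section SelfAdjoint.
Context {H : hilbertType R}.
Implicit Types (B : operator H) (z : R[i]).

Lemma adjoint_graph_unique (K : hilbertType R) (S : set H) (f : H -> K) v w w' :
  dense S -> adjoint_graph S f v w -> adjoint_graph S f v w' -> w = w'.
Proof.
move=> dS h h'; apply/subr0_eq/(dense_orthogonal dS) => y Sy.
by rewrite dotBr -h // h' // subrr.
Qed.

Lemma adjoint_eq B v w :
  densely_defined B -> adjoint_graph (dom B) B v w -> adjoint B v = w.
Proof.
move=> dB h; apply: xget_unique => // w' h'; exact: adjoint_graph_unique dB h' h.
Qed.

Lemma adjoint_spec B v : dom (adjoint B) v ->
  adjoint_graph (dom B) B v (adjoint B v).
Proof. by move=> h; apply: (@xgetPex H 0). Qed.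

(** Symmetry plus maximality: the chosen value of [adjoint_fun] is traded for the relation
    [adjoint_graph], which density makes single-valued. *)
Lemma selfadjointP B : selfadjoint B <->
  [/\ linear_operator B, densely_defined B, symmetric_operator B &
    forall v w, adjoint_graph (dom B) B v w -> dom B v /\ B v = w].
Proof.
split=> [[lB dB [BB' BB'2] [B'B B'B2]]|[lB dB sB mB]].
  split=> // [u v Bu Bv|v w vw].
    by rewrite -(B'B2 v Bv); apply: (adjoint_spec (B'B v Bv)).
  have Bv : dom B v by apply: BB'; exists w.
  by split=> //; rewrite -(B'B2 v Bv); exact: adjoint_eq.
have Badj v : dom B v -> adjoint_graph (dom B) B v (B v).
  by move=> Bv u Bu; apply: sB.
split=> //; split.
- by move=> v [w vw]; case: (mB v w vw).
- by move=> v [w vw]; rewrite (adjoint_eq dB vw); case: (mB v w vw).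
- by move=> v Bv; exists (B v); apply: Badj.
- by move=> v Bv; rewrite (adjoint_eq dB (Badj v Bv)).
Qed.

Lemma selfadjoint_perturb B (V : H -> H) :
  selfadjoint B -> selfadjoint_bounded V -> selfadjoint (perturb B V).
Proof.
move=> /selfadjointP[[B0 lB] dB sB mB] [[lV _] sV]; apply/selfadjointP; split=> //.
- split=> // a u v Bu Bv; have [Buv BE] := lB a u v Bu Bv; split=> //=.
  by rewrite BE lV scalerDr addrACA.
- by move=> u v Bu Bv /=; rewrite dotDl dotDr sB // sV.
- move=> v w vw; have [|Bv BE] := mB v (w - V v).
    move=> u Bu; have := vw u Bu; rewrite /= dotDl dotBr => <-.
    by rewrite sV addrK.
  by split=> //=; rewrite BE subrK.
Qed.

(** Symmetry of [B] on [dom A] makes [B u] represent [u] in the adjoint of [A]. Green's formula,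
    stated for [adjoint A], thereby applies to every self-adjoint extension. *)
Lemma adjoint_extension (A B : operator H) u :
  densely_defined A -> extends B A -> selfadjoint B -> dom B u -> adjoint A u = B u.
Proof.
move=> dA [AB BA] /selfadjointP[_ _ sB _] Bu; apply: adjoint_eq => // v Av.
by rewrite -BA // sB //; apply: AB.
Qed.

Lemma resolvent_spec B z f : resolvent_set B z ->
  dom B (resolvent B z f) /\ B (resolvent B z f) - z *: resolvent B z f = f.
Proof.
move=> [/(_ f)[u [uf _]] _].
by apply: (@xgetPex H 0 [set u | dom B u /\ B u - z *: u = f]); exists u.
Qed.

Lemma resolventK B z u : resolvent_set B z -> dom B u ->
  resolvent B z (B u - z *: u) = u.
Proof.
move=> Bz Bu; have [Rd RE] := resolvent_spec (B u - z *: u) Bz.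
case: Bz => /(_ (B u - z *: u))[w [_ w_uniq]] _.
by rewrite -(w_uniq _ (conj Rd RE)); apply: w_uniq.
Qed.

Lemma resolvent_linear B z : linear_operator B ->
  (forall f, exists! u, dom B u /\ B u - z *: u = f) -> linear (resolvent B z).
Proof.
move=> [_ lB] hz a f g.
have spec h : dom B (resolvent B z h) /\ B (resolvent B z h) - z *: resolvent B z h = h.
  have [u [uf _]] := hz h.
  by apply: (@xgetPex H 0 [set u | dom B u /\ B u - z *: u = h]); exists u.
have [w [_ w_uniq]] := hz (a *: f + g).
rewrite -(w_uniq _ (spec _)).
have [fd fE] := spec f; have [gd gE] := spec g.
have [dd dE] := lB a _ _ fd gd.
apply: w_uniq; split=> //; rewrite dE -[in RHS]fE -[in RHS]gE scalerDr scalerA mulrC -scalerA.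
by rewrite scalerBr opprD addrACA.
Qed.

Lemma selfadjoint_quadratic_real B u : selfadjoint B -> dom B u ->
  (hdot (B u) u)^*%C = hdot (B u) u.
Proof. by move=> /selfadjointP[_ _ sB _] Bu; rewrite -dotC sB. Qed.

(** As <B u, u> is real, the cross term depends on Re z alone. *)
Lemma nrm_sub_conj B z u : selfadjoint B -> dom B u ->
  nrm (B u - z^*%C *: u) = nrm (B u - z *: u).
Proof.
move=> saB Bu; apply/eqP.
rewrite -(@eqrXn2 _ 2) ?nrm_ge0 //; apply/eqP.
rewrite !nrm_sqrD !nrmN !nrmZ nrmJ !dotNr !dotZr conjcK.
have := selfadjoint_quadratic_real saB Bu; case: (hdot _ _) => a b [] bE.
have {bE} -> : b = 0 by lra.
by case: z => c d /=; congr (_ + _ * _); ring.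
Qed.

Lemma nrm_sub_i B u : selfadjoint B -> dom B u -> nrm u <= nrm (B u - 'i *: u).
Proof.
move=> saB Bu.
rewrite -(@ler_pXn2r _ 2) ?nnegrE ?nrm_ge0 //.
rewrite !nrm_sqrD !nrmN !nrmZ nrmi !dotNr !dotZr.
have := selfadjoint_quadratic_real saB Bu; case: (hdot _ _) => a b [] bE.
have {bE} -> : b = 0 by lra.
rewrite /= mul1r; have := sqr_ge0 (nrm (B u)); lra.
Qed.

(** The lower bound gives injectivity and closed range. A vector orthogonal to the range is an
    eigenvector of [B] at conj z or zero, and the lower bound holds there as well, so the range is
    everything. *)
Theorem selfadjoint_resolvent B z (c : R) : selfadjoint B -> 0 <= c ->
  (forall u, dom B u -> nrm u <= c * nrm (B u - z *: u)) ->
  resolvent_set B z /\ opbd (resolvent B z) c.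
Proof.
move=> saB c0 low; have /selfadjointP[[B0 lB] dB sB mB] := saB.
have B00 : B 0 = 0.
  have [_] := lB 1 0 0 B0 B0; rewrite !scale1r addr0 => /eqP.
  by rewrite -subr_eq0 opprD addNKr oppr_eq0 => /eqP.
have lz a u v : dom B u -> dom B v -> dom B (a *: u + v) /\
    B (a *: u + v) - z *: (a *: u + v) = a *: (B u - z *: u) + (B v - z *: v).
  move=> Bu Bv; have [Buv ->] := lB a u v Bu Bv; split=> //.
  by rewrite scalerDr scalerBr scalerA mulrC -scalerA opprD addrACA.
have lowB u v : dom B u -> dom B v ->
    nrm (u - v) <= c * nrm ((B u - z *: u) - (B v - z *: v)).
  move=> Bu Bv; have [Buv E] := lz (-1) v u Bv Bu.
  by have := low _ Buv; rewrite E !scaleN1r addrC [_ - _ *: _ + _]addrC [- _ + (B u - _)]addrC.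
pose M := [set f | exists2 u, dom B u & B u - z *: u = f].
have surj f : M f.
  have [| | |m Mm mM] := @orthogonal_decomposition _ M f.
  - by exists 0 => //; rewrite B00 scaler0 subr0.
  - move=> a _ _ [u Bu <-] [v Bv <-]; have [Buv E] := lz a u v Bu Bv.
    by exists (a *: u + v).
  - move=> fs l Mfs fl.
    have {Mfs} /choice[us usP] n : exists u, dom B u /\ B u - z *: u = fs n.
      by have [u Bu uE] := Mfs n; exists u.
    have Bus n : dom B (us n) by case: (usP n).
    have usE n : B (us n) - z *: us n = fs n by case: (usP n).
    have [u uu] : exists u, cvs us u.
      apply: nrm_complete => e e0.
      have [|N hN] := fl (e / (2 * (c + 1))).
        by rewrite divr_gt0 ?mulr_gt0 // ltr_wpDl.
      exists N => n Nn; apply: (le_lt_trans (lowB _ _ (Bus _) (Bus _))).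
      rewrite !usE.
      have h1 := hN n Nn; have h2 := hN N (leqnn N).
      have := nrm_dist_triangle l (fs n) (fs N); rewrite (nrm_distC l).
      have : 0 < c + 1 by rewrite ltr_wpDl.
      move: h1 h2; set p := nrm _; set q := nrm _; set r := nrm _ => h1 h2 c1 h3.
      have h4 : r < e / (c + 1).
        apply: (le_lt_trans h3).
        have -> : e / (c + 1) = e / (2 * (c + 1)) + e / (2 * (c + 1)).
          by field; rewrite gt_eqF.
        by apply: ltrD.
      move: h4; rewrite ltr_pdivlMr //; have := nrm_ge0 (fs n - fs N); rewrite -/r; lra.
    (* Self-adjointness makes [B] closed: the relation <B w, u> = <w, l + z u> passes to the limit,
       and maximality puts [u] in the domain. *)
    have [|Bu Bl] := mB u (l + z *: u).
      move=> w Bw.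
      have lim1 := cvs_dotr (B w - z^*%C *: w) uu.
      have lim2 := cvs_dotr w fl.
      have same : (fun n => hdot (B w - z^*%C *: w) (us n)) = (fun n => hdot w (fs n)).
        apply/funext => n; rewrite -usE dotBl dotBr dotZl dotZr.
        by rewrite sB.
      rewrite same in lim1; have := cvs_unique lim1 lim2.
      by rewrite dotBl dotZl dotDr dotZr => /eqP; rewrite subr_eq => /eqP.
    by exists u => //; rewrite Bl addrK.
  have [|Bw Ew] := mB (f - m) (z^*%C *: (f - m)).
    move=> u Bu; have := mM (B u - z *: u).
    rewrite dotC => /(_ _)/(congr1 (@conjc R)); rewrite conjcK rmorph0 => h.
    apply/subr0_eq; rewrite dotZr conjcK -dotZl -dotBl; apply: h.
    by exists u.
  have := low _ Bw; rewrite -nrm_sub_conj // Ew subrr nrm0 mulr0 => w0.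
  suff /nrm_eq0/subr0_eq -> : nrm (f - m) = 0 by [].
  by apply/eqP; rewrite eq_le w0 nrm_ge0.
have uniq f : exists! u, dom B u /\ B u - z *: u = f.
  have [u Bu <-] := surj f; exists u; split=> // v [Bv vE].
  apply/subr0_eq/nrm_eq0/eqP; rewrite eq_le nrm_ge0 andbT.
  by apply: (le_trans (lowB _ _ Bu Bv)); rewrite vE subrr nrm0 mulr0.
have Rc : opbd (resolvent B z) c.
  move=> f; have [u [uf _]] := uniq f.
  have [Rd RE] : [set u | dom B u /\ B u - z *: u = f] (resolvent B z f).
    by apply: xgetPex; exists u.
  by have := low _ Rd; rewrite RE.
split=> //; split=> //; apply: opbd_bounded_op Rc => //.
by apply: resolvent_linear.
Qed.

Lemma resolvent_set_lower_bound B z : resolvent_set B z ->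
  exists2 c : R, 0 <= c & opbd (resolvent B z) c.
Proof. by move=> [_ /bounded_op_opbd]. Qed.

(** A bound of the resolvent at [z] is a lower bound for B - z, hence for B - conj z. *)
Lemma resolvent_set_conj B z : selfadjoint B -> resolvent_set B z ->
  resolvent_set B z^*%C.
Proof.
move=> saB Bz; have [c c0 hc] := resolvent_set_lower_bound Bz.
have [] // := selfadjoint_resolvent (z := z^*%C) saB c0.
move=> u Bu; rewrite nrm_sub_conj //; have := hc (B u - z *: u).
by rewrite resolventK.
Qed.

Lemma resolvent_opbd_conj B z (c : R) : selfadjoint B -> resolvent_set B z ->
  0 <= c -> opbd (resolvent B z) c -> opbd (resolvent B z^*%C) c.
Proof.
move=> saB Bz c0 hc.
have [|] // := selfadjoint_resolvent (z := z^*%C) saB c0.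
move=> u Bu; rewrite nrm_sub_conj //; have := hc (B u - z *: u).
by rewrite resolventK.
Qed.

Lemma resolvent_set_i B : selfadjoint B -> resolvent_set B 'i.
Proof.
move=> saB; have [] // := selfadjoint_resolvent (z := 'i) saB (ler01 : 0 <= (1 : R)).
by move=> u Bu; rewrite mul1r nrm_sub_i.
Qed.

Lemma resolvent_adjoint B z f g : selfadjoint B -> resolvent_set B z ->
  hdot (resolvent B z f) g = hdot f (resolvent B z^*%C g).
Proof.
move=> saB Bz; have /selfadjointP[_ _ sB _] := saB.
have [Rd RE] := resolvent_spec f Bz.
have [Rd' RE'] := resolvent_spec g (resolvent_set_conj saB Bz).
by rewrite -{1}RE' -{2}RE dotBl dotBr dotZl dotZr conjcK sB.
Qed.

End SelfAdjoint.
End HilbertSpace.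

(** * Green's formula for perturbed boundary data *)

Section Symplectic.
Context {R : realType} {K : hilbertType R}.
Implicit Types f g : hsum K K.

Lemma J_linear : linear (@J R K).
Proof.
move=> a f g; rewrite /J; congr pair => /=.
by rewrite opprD scalerN.
Qed.

Lemma nrm_J f : nrm (J f) = nrm f.
Proof.
apply/eqP; rewrite -(@eqrXn2 _ 2) ?nrm_ge0 //; apply/eqP/realC_inj.
rewrite -!dot_nrm [LHS]/(hdot f.2 f.2 + hdot (- f.1) (- f.1)).
rewrite [RHS]/(hdot f.1 f.1 + hdot f.2 f.2) dotNl dotNr opprK; exact: addrC.
Qed.

Lemma omegaE f g : omega f g = hdot f.2 g.1 - hdot f.1 g.2.
Proof. by rewrite [LHS]/(hdot f.2 g.1 + hdot (- f.1) g.2) dotNl. Qed.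

End Symplectic.

(** * Boundary data at two parameters and the resulting form estimate *)

Section BoundaryPairs.
Context {R : realType} {H K : hilbertType R} {D : completeNormedModType R[i]}.
Variables (A : operator H) (iota : {linear D -> H}) (ci : R).
Hypotheses (A_dense : densely_defined A) (iota_inj : injective iota).
Hypotheses (ci0 : 0 <= ci) (iota_bd : opbd iota ci).

(** The facts at a single parameter: the Lagrangian range enters as Q J Q = 0 ([bd_isotropic]), the
    trace condition as Q T = T on the domain ([bd_trace]). *)
Record boundary_data (T : D -> hsum K K) (Q : hsum K K -> hsum K K)
    (B : operator H) (V : H -> H) : Prop := BoundaryData {
  bd_T : linear T;
  bd_green : forall x y : D,
    hdot (adjoint A (iota x)) (iota y) - hdot (iota x) (adjoint A (iota y))
    = omega (T x) (T y);
  bd_Q : orthogonal_projection Q;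
  bd_isotropic : forall f g, omega (Q f) (Q g) = 0;
  bd_sa : selfadjoint B;
  bd_ext : extends B A;
  bd_dom : dom B `<=` range iota;
  bd_trace : forall x, dom B (iota x) -> Q (T x) = T x;
  bd_V : selfadjoint_bounded V }.

Lemma iota_lift u : range iota u -> iota (Defs.lift iota u) = u.
Proof. by move=> [d _ du]; apply: (@xgetPex D 0 [set d | iota d = u]); exists d. Qed.

Lemma iota_resolventD B z f : dom B `<=` range iota -> resolvent_set B z ->
  iota (resolventD iota B z f) = resolvent B z f.
Proof.
by move=> Bi Bz; apply: iota_lift; apply: Bi; case: (resolvent_spec f Bz).
Qed.

Lemma resolventD_linear B z : dom B `<=` range iota -> resolvent_set B z ->
  linear (resolventD iota B z).
Proof.
move=> Bi Bz a f g; apply: iota_inj; rewrite linearP !iota_resolventD //; exact: Bz.2.1.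
Qed.

(** The graph is closed because convergence in [D] implies convergence in [H], where the resolvent
    is already bounded, and [iota] is injective. *)
Lemma resolventD_bounded B z : dom B `<=` range iota -> resolvent_set B z ->
  exists2 C : R, 0 <= C & opbd (resolventD iota B z) C.
Proof.
move=> Bi Bz; apply: closed_graph; first exact: resolventD_linear.
move=> f l x fl fx; apply: iota_inj; rewrite iota_resolventD //.
have [M M0 RM] := resolvent_set_lower_bound Bz.
have lim1 := opbd_cvs Bz.2.1 RM fl.
have lim2 := opbd_cvs (@linearP _ _ _ _ iota) iota_bd fx.
apply: (cvs_unique lim1); move: lim2.
rewrite (_ : iota \o _ = resolvent B z \o f) //.
by apply/funext => n; rewrite /= iota_resolventD.
Qed.

Section Identity.
Variables (T0 T : D -> hsum K K) (Q0 Q : hsum K K -> hsum K K).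
Variables (B0 B : operator H) (V0 V : H -> H).
Hypotheses (bd0 : boundary_data T0 Q0 B0 V0) (bd1 : boundary_data T Q B V).
Let H0 := perturb B0 V0.
Let H1 := perturb B V.

(* Green's formula for [T0], in which [J (T x)] is replaced by
   [(Q0 - Q) (J (T x))]: [T0 y] lies in [ran Q0] and [Q J Q = 0]. *)
Lemma perturbed_green (z : R[i]) (x y : D) : dom B (iota x) -> dom B0 (iota y) ->
  hdot (H1 (iota x) - z *: iota x) (iota y)
    - hdot (iota x) (H0 (iota y) - z^*%C *: iota y)
  = hdot (J (T0 x - T x)) (T0 y) + hdot (Q0 (J (T x)) - Q (J (T x))) (T0 y)
    + hdot (V (iota x) - V0 (iota x)) (iota y).
Proof.
move=> Bx By.
have E1 := adjoint_extension A_dense bd1.(bd_ext) bd1.(bd_sa) Bx.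
have E0 := adjoint_extension A_dense bd0.(bd_ext) bd0.(bd_sa) By.
have G := bd0.(bd_green) x y.
have [[_ sQ0] Q0Q0] := bd0.(bd_Q).
have [[_ sQ] QQ] := bd1.(bd_Q).
have [_ sV0] := bd0.(bd_V).
rewrite /H1 /H0 /= -E1 -E0 !dotBl !dotBr !dotDl !dotDr !dotZl !dotZr conjcK.
rewrite (linearP_B J_linear) dotBl sQ0 bd0.(bd_trace) // sV0.
(* [Q] moves onto [T0 y] and [T x = Q (T x)], which leaves [omega] of two vectors of ran Q. *)
have -> : hdot (Q (J (T x))) (T0 y) = 0.
  by rewrite sQ -(bd1.(bd_trace) Bx); exact: bd1.(bd_isotropic).
have -> : hdot (adjoint A (iota x)) (iota y) =
   hdot (iota x) (adjoint A (iota y)) + hdot (J (T0 x)) (T0 y).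
  by apply/eqP; rewrite addrC -subr_eq G.
ring.
Qed.

Definition close_data (d : R) : Prop :=
  [/\ opbd (T \- T0) d, opbd (V \- V0) d & opbd (Q \- Q0) d].

Variables (d cT : R).
Hypotheses (d_ge0 : 0 <= d) (d_le1 : d <= 1) (cl : close_data d).
Hypotheses (cT0 : 0 <= cT) (T0_bd : opbd T0 cT).

Lemma close_T_bd : opbd T (cT + 1).
Proof.
move=> x; have [h _ _] := cl; have := h x; have := T0_bd x.
have := nrmD (T x - T0 x) (T0 x); rewrite subrK /=.
have := nrm_ge0 x; set p := nrm _; set q := nrm _; set r := nrm _; set s := nrm _.
move=> p0 h1 h2 h3; have : d * p <= 1 * p by rewrite ler_wpM2r.
lra.
Qed.

(** One summand per term of [perturbed_green]: traces, projections (where |T x| is at most [cT + 1]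
    times |x|), and potentials, with [ci] from each embedding into [H]. *)
Definition krein_const : R := cT + (cT + 1) * cT + ci * ci.

Lemma krein_const_ge0 : 0 <= krein_const.
Proof. by rewrite /krein_const !addr_ge0 ?mulr_ge0 ?addr_ge0. Qed.

Lemma perturbed_green_le (z : R[i]) (x y : D) : dom B (iota x) -> dom B0 (iota y) ->
  nrm (hdot (H1 (iota x) - z *: iota x) (iota y)
    - hdot (iota x) (H0 (iota y) - z^*%C *: iota y))
  <= krein_const * d * nrm x * nrm y.
Proof.
move=> Bx By; rewrite (perturbed_green z Bx By).
have [hT hV hQ] := cl.
have p0 := nrm_ge0 x; have q0 := nrm_ge0 y.
have b1 : nrm (hdot (J (T0 x - T x)) (T0 y)) <= (d * nrm x) * (cT * nrm y).
  apply: (le_trans (cauchy_schwarz _ _)); rewrite nrm_J nrm_distC.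
  by apply: ler_pM; rewrite ?nrm_ge0 //; exact: hT.
have b2 : nrm (hdot (Q0 (J (T x)) - Q (J (T x))) (T0 y)) <=
    (d * ((cT + 1) * nrm x)) * (cT * nrm y).
  apply: (le_trans (cauchy_schwarz _ _)); rewrite nrm_distC.
  apply: ler_pM; rewrite ?nrm_ge0 //; apply: (le_trans (hQ _)).
  by rewrite ler_wpM2l // nrm_J; exact: close_T_bd.
have b3 : nrm (hdot (V (iota x) - V0 (iota x)) (iota y)) <=
    (d * (ci * nrm x)) * (ci * nrm y).
  apply: (le_trans (cauchy_schwarz _ _)).
  apply: ler_pM; rewrite ?nrm_ge0 //; apply: (le_trans (hV _)).
  by rewrite ler_wpM2l //; exact: iota_bd.
apply: (le_trans (nrmD _ _)); apply: (le_trans (lerD (nrmD _ _) (lexx _))).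
apply: (le_trans (lerD (lerD b1 b2) b3)).
by rewrite le_eqVlt; apply/orP; left; apply/eqP; rewrite /krein_const; ring.
Qed.

End Identity.

Section GraphNorm.
Variables (T : D -> hsum K K) (Q : hsum K K -> hsum K K).
Variables (B : operator H) (V : H -> H) (C v : R).
Hypotheses (bd : boundary_data T Q B V) (C0 : 0 <= C) (v0 : 0 <= v).
Hypotheses (C_bd : opbd (resolventD iota B 'i) C) (V_bd : opbd V v).

Lemma resolventD_perturb (z : R[i]) (x : D) : dom B (iota x) ->
  x = resolventD iota B 'i
        (perturb B V (iota x) - z *: iota x + (z - 'i) *: iota x - V (iota x)).
Proof.
move=> Bx; rewrite /perturb /=; apply: iota_inj.
have Bi := resolvent_set_i bd.(bd_sa).
rewrite iota_resolventD //; last exact: bd.(bd_dom).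
rewrite (_ : _ - V (iota x) = B (iota x) - 'i *: iota x) ?resolventK //.
rewrite scalerBl addrA subrK; rewrite [LHS](ACl (1*3*(2*4))) /=.
by rewrite subrr addr0.
Qed.

(** Converts the [D]-norms of the form estimate back into norms of [H]; [C] is the assumed bound on
    (B - i)^{-1} in B(H, D). *)
Lemma nrm_le_graph (z : R[i]) (x : D) : dom B (iota x) ->
  nrm x <= C * (nrm (perturb B V (iota x) - z *: iota x)
                + (nrm z + 1 + v) * nrm (iota x)).
Proof.
move=> Bx; rewrite {1}(resolventD_perturb z Bx).
apply: (le_trans (C_bd _)); rewrite ler_wpM2l //.
apply: (le_trans (nrmB _ _)); apply: (le_trans (lerD (nrmD _ _) (V_bd _))).
rewrite nrmZ -addrA lerD2l mulrDl lerD2r ler_wpM2r ?nrm_ge0 //.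
by have := nrmB z 'i; rewrite nrmi.
Qed.

Lemma resolventD_perturb_opbd (z : R[i]) (M : R) :
  resolvent_set (perturb B V) z -> 0 <= M -> opbd (resolvent (perturb B V) z) M ->
  opbd (resolventD iota (perturb B V) z) (C * (1 + (nrm z + 1 + v) * M)).
Proof.
move=> Hz M0 HM f.
have [Rd RE] := resolvent_spec f Hz.
have xE := @iota_resolventD (perturb B V) z f bd.(bd_dom) Hz.
have := @nrm_le_graph z (resolventD iota (perturb B V) z f).
rewrite xE RE => /(_ Rd) /le_trans; apply.
rewrite -mulrA ler_wpM2l // [leRHS]mulrDl mul1r lerD2l -mulrA ler_wpM2l ?HM //.
by rewrite !addr_ge0 ?nrm_ge0.
Qed.

End GraphNorm.

Section Stability.
Variables (T0 : D -> hsum K K) (Q0 : hsum K K -> hsum K K).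
Variables (B0 : operator H) (V0 : H -> H).
Hypothesis bd0 : boundary_data T0 Q0 B0 V0.
Let H0 := perturb B0 V0.
Variables (cT v C : R).
Hypotheses (cT0 : 0 <= cT) (T0_bd : opbd T0 cT) (v0 : 0 <= v) (V0_bd : opbd V0 v).
Hypothesis C0 : 0 <= C.
Variable z0 : R[i].
Hypothesis Hz0 : resolvent_set H0 z0.

(** Dominates the factor |z| + 1 + |V| of [nrm_le_graph], as |z| <= |z0| + 1 and |V| <= v + 1. *)
Let kz : R := nrm z0 + 3 + v.

(* Test [perturbed_green] against [y = R_0(conj z0) u]: the boundary terms carry the
   factor [d], so they are absorbed into [nrm u] once [d] is small. *)
Lemma stable_lower_bound : exists eps delta M : R,
  [/\ 0 < eps, 0 < delta, eps <= 1, delta <= 1 & 0 <= M /\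
    forall T Q B V (d : R), boundary_data T Q B V -> opbd (resolventD iota B 'i) C ->
      0 <= d -> d <= delta -> close_data T0 T Q0 Q V0 V d ->
      forall z : R[i], nrm (z - z0) <= eps -> forall u, dom B u ->
        nrm u <= M * nrm (perturb B V u - z *: u)].
Proof.
have saH0 : selfadjoint H0 := selfadjoint_perturb bd0.(bd_sa) bd0.(bd_V).
have Hz0' := resolvent_set_conj saH0 Hz0.
have [M1 M10 RM1] := resolvent_set_lower_bound Hz0'.
have [M0 M00 M0bd] : exists2 M0 : R, 0 <= M0 & opbd (resolventD iota H0 z0^*%C) M0.
  by apply: resolventD_bounded Hz0'; exact: bd0.(bd_dom).
have kz0 : 0 <= kz by rewrite /kz !addr_ge0 ?nrm_ge0.
have [L [L0 LE]] : exists L : R, 0 <= L /\ L = krein_const cT.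
  by exists (krein_const cT); split=> //; exact: krein_const_ge0.
(* [P] is the coefficient of d |u|^2 in the boundary terms. [eps] and [delta] reduce each of the two
   errors to a quarter of |u|^2; absorbing this half produces the factor 2 in the final constant. *)
pose P := L * M0 * C * kz.
have P0 : 0 <= P by rewrite /P !mulr_ge0.
pose eps := (4 * (M1 + 1))^-1; pose delta := (4 * (P + 1))^-1.
have eps0 : 0 < eps by rewrite invr_gt0 mulr_gt0 // ltr_wpDl.
have delta0 : 0 < delta by rewrite invr_gt0 mulr_gt0 // ltr_wpDl.
have eps1 : eps <= 1 by rewrite invf_le1 ?mulr_gt0 ?ltr_wpDl //; lra.
have delta1 : delta <= 1 by rewrite invf_le1 ?mulr_gt0 ?ltr_wpDl //; lra.
have epsM : eps * M1 <= 1 / 4.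
  rewrite /eps mulrC ler_pdivrMr ?mulr_gt0 ?ltr_wpDl //; lra.
have deltaP : delta * P <= 1 / 4.
  rewrite /delta mulrC ler_pdivrMr ?mulr_gt0 ?ltr_wpDl //; lra.
exists eps, delta, (2 * (M1 + L * M0 * C)); split=> //; split.
  by rewrite mulr_ge0 // addr_ge0 // !mulr_ge0.
move=> T Q B V d bd CB d0 dd cl z zz u Bu.
have d1 : d <= 1 := le_trans dd delta1.
pose x := Defs.lift iota u; have xu : iota x = u by apply/iota_lift/bd.(bd_dom).
pose y := resolventD iota H0 z0^*%C u.
have yE : iota y = resolvent H0 z0^*%C u.
  by apply: iota_resolventD Hz0'; exact: bd0.(bd_dom).
have [yd yR] := resolvent_spec u Hz0'.
have Vbd : opbd V (v + 1).
  move=> w; have [_ h _] := cl; have := h w; have := V0_bd w.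
  have := nrmD (V w - V0 w) (V0 w); rewrite subrK /=.
  have := nrm_ge0 w; set p := nrm _; set q := nrm _; set r := nrm _; set s := nrm _.
  move=> p0 h1 h2 h3; have : d * p <= 1 * p by rewrite ler_wpM2r.
  lra.
have v10 : 0 <= v + 1 by rewrite addr_ge0.
have Bx : dom B (iota x) by rewrite xu.
have By : dom B0 (iota y) by rewrite yE.
have key := perturbed_green_le bd0 bd d0 d1 cl T0_bd z Bx By.
have gx := nrm_le_graph bd C0 CB Vbd z Bx.
rewrite xu in key gx.
set f := perturb B V u - z *: u in key gx *.
(* [y] solves the equation at conj z0; passing to conj z costs a multiple of |z - z0| <= [eps]. *)
have HE : H0 (iota y) - z^*%C *: iota y = u + (z0^*%C - z^*%C) *: iota y.
  by rewrite -[in RHS]yR yE scalerBl addrA subrK.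
rewrite HE dotDr dotZr in key.
have gx' : nrm x <= C * (nrm f + kz * nrm u).
  apply: (le_trans gx); rewrite ler_wpM2l // lerD2l ler_wpM2r ?nrm_ge0 //.
  have := nrmD (z - z0) z0; rewrite subrK /kz; lra.
have gy : nrm y <= M0 * nrm u by exact: M0bd.
have gy' : nrm (iota y) <= M1 * nrm u by rewrite yE; exact: RM1.
have main : nrm u ^+ 2 <= nrm f * nrm (iota y) + eps * (nrm u * nrm (iota y))
     + L * d * nrm x * nrm y.
  have -> : nrm u ^+ 2 = nrm (hdot u u) by rewrite dot_nrm nrm_real ger0_norm ?sqr_ge0.
  set a := hdot f (iota y) in key; set b := hdot u u in key *.
  set c := _ * hdot u (iota y) in key.
  have ha : nrm a <= nrm f * nrm (iota y) by exact: cauchy_schwarz.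
  have hc : nrm c <= eps * (nrm u * nrm (iota y)).
    rewrite /c nrmM nrmJ; apply: ler_pM; rewrite ?nrm_ge0 ?cauchy_schwarz //.
    by rewrite -rmorphB nrmJ nrm_distC.
  have := nrmB (a - c) (a - (b + c)).
  have -> : a - c - (a - (b + c)) = b by ring.
  have := nrmB a c; move: key; rewrite -LE; lra.
have [->|u0] := eqVneq u 0.
  by rewrite nrm0 mulr_ge0 ?nrm_ge0 // mulr_ge0 // addr_ge0 // !mulr_ge0.
rewrite -nrm_gt0 in u0.
have nf := nrm_ge0 f; have ny := nrm_ge0 y; have nx := nrm_ge0 x.
have b1 : nrm f * nrm (iota y) <= nrm f * (M1 * nrm u) by rewrite ler_wpM2l.
have b2 : eps * (nrm u * nrm (iota y)) <= 1 / 4 * nrm u * nrm u.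
  apply: (@le_trans _ _ (eps * (nrm u * (M1 * nrm u)))).
    by rewrite ler_wpM2l ?(ltW eps0) // ler_wpM2l ?nrm_ge0.
  have -> : eps * (nrm u * (M1 * nrm u)) = eps * M1 * nrm u * nrm u by ring.
  by rewrite ler_wpM2r ?nrm_ge0 // ler_wpM2r ?nrm_ge0.
have b3 : L * d * nrm x * nrm y <= (L * M0 * C * nrm f + 1 / 4 * nrm u) * nrm u.
  apply: (@le_trans _ _ (L * d * (C * (nrm f + kz * nrm u)) * (M0 * nrm u))).
    apply: ler_pM => //; first by rewrite !mulr_ge0.
    by rewrite ler_wpM2l // mulr_ge0.
  have -> : L * d * (C * (nrm f + kz * nrm u)) * (M0 * nrm u) =
    (d * (L * M0 * C * nrm f) + d * P * nrm u) * nrm u by rewrite /P; ring.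
  rewrite ler_wpM2r ?nrm_ge0 //; apply: lerD.
    by rewrite -[leRHS]mul1r ler_wpM2r // !mulr_ge0.
  rewrite ler_wpM2r ?nrm_ge0 //; apply: le_trans deltaP.
  by rewrite ler_wpM2r.
have : nrm u * nrm u <= ((M1 + L * M0 * C) * nrm f + 1 / 2 * nrm u) * nrm u.
  by move: main; rewrite expr2; lra.
rewrite ler_pM2r //; lra.
Qed.

End Stability.
End BoundaryPairs.

(** * Difference and first-order expansion of two resolvents *)

Section ResolventPerturbation.
Context {R : realType} {H K : hilbertType R} {D : completeNormedModType R[i]}.
Variables (A : operator H) (iota : {linear D -> H}) (ci : R).
Hypotheses (A_dense : densely_defined A) (iota_inj : injective iota).
Hypotheses (ci0 : 0 <= ci) (iota_bd : opbd iota ci).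

Section TwoOperators.
Variables (T0 T : D -> hsum K K) (Q0 Q : hsum K K -> hsum K K).
Variables (B0 B : operator H) (V0 V : H -> H).
Hypotheses (bd0 : boundary_data A iota T0 Q0 B0 V0).
Hypotheses (bd1 : boundary_data A iota T Q B V).
Let H0 := perturb B0 V0.
Let H1 := perturb B V.
Variable z : R[i].
Hypotheses (Hz0 : resolvent_set H0 z) (Hz : resolvent_set H1 z).

Lemma resolvent_difference f g :
  let x := resolventD iota H1 z f in let y := resolventD iota H0 z^*%C g in
  hdot (resolvent H1 z f - resolvent H0 z f) g =
  hdot (J (T x - T0 x)) (T0 y) + hdot (Q (J (T x)) - Q0 (J (T x))) (T0 y)
  - hdot (V (iota x) - V0 (iota x)) (iota y).
Proof.
move=> x y.
have saH0 : selfadjoint H0 := selfadjoint_perturb bd0.(bd_sa) bd0.(bd_V).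
have Hz0' := resolvent_set_conj saH0 Hz0.
have xE : iota x = resolvent H1 z f.
  by apply: iota_resolventD Hz; exact: bd1.(bd_dom).
have yE : iota y = resolvent H0 z^*%C g.
  by apply: iota_resolventD Hz0'; exact: bd0.(bd_dom).
have [xd xR] := resolvent_spec f Hz; have [yd yR] := resolvent_spec g Hz0'.
have Bx : dom B (iota x) by rewrite xE.
have By : dom B0 (iota y) by rewrite yE.
have := perturbed_green A_dense bd0 bd1 z Bx By.
rewrite -/H1 -/H0; move: xR yR; rewrite -xE -yE => -> -> E.
have -> : hdot (iota x - resolvent H0 z f) g = - (hdot f (iota y) - hdot (iota x) g).
  by rewrite dotBl (resolvent_adjoint _ _ saH0 Hz0) -yE opprB.
have JN : J (T0 x - T x) = - J (T x - T0 x).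
  by rewrite -(opprB (T x)) -scaleN1r (linearP_Z J_linear) scaleN1r.
rewrite E JN -(opprB (Q (J (T x)))) !dotNl; ring.
Qed.

Variables (d cT M : R).
Hypotheses (d_ge0 : 0 <= d) (d_le1 : d <= 1) (cl : close_data T0 T Q0 Q V0 V d).
Hypotheses (cT0 : 0 <= cT) (T0_bd : opbd T0 cT) (M_ge0 : 0 <= M).
Hypotheses (M1 : opbd (resolventD iota H1 z) M)
  (M0' : opbd (resolventD iota H0 z^*%C) M).

Lemma resolvent_difference_le :
  opbd (resolvent H1 z \- resolvent H0 z) (krein_const ci cT * M * M * d).
Proof.
move=> f; apply: nrm_le_dot.
  by rewrite !mulr_ge0 ?nrm_ge0 ?krein_const_ge0.
move=> g /=.
have saH0 : selfadjoint H0 := selfadjoint_perturb bd0.(bd_sa) bd0.(bd_V).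
have Hz0' := resolvent_set_conj saH0 Hz0.
pose x := resolventD iota H1 z f; pose y := resolventD iota H0 z^*%C g.
have xE : iota x = resolvent H1 z f.
  by apply: iota_resolventD Hz; exact: bd1.(bd_dom).
have yE : iota y = resolvent H0 z^*%C g.
  by apply: iota_resolventD Hz0'; exact: bd0.(bd_dom).
have [xd xR] := resolvent_spec f Hz; have [yd yR] := resolvent_spec g Hz0'.
have Bx : dom B (iota x) by rewrite xE.
have By : dom B0 (iota y) by rewrite yE.
have := perturbed_green_le A_dense iota_bd bd0 bd1 d_ge0 d_le1 cl T0_bd z Bx By.
rewrite -/H1 -/H0 xE yE xR yR -(resolvent_adjoint _ _ saH0 Hz0) -dotBl.
rewrite -opprB dotNl nrmN => /le_trans; apply.
have -> : krein_const ci cT * M * M * d * nrm f * nrm g =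
  krein_const ci cT * d * (M * nrm f) * (M * nrm g) by ring.
have k0 : 0 <= krein_const ci cT * d by rewrite mulr_ge0 ?krein_const_ge0.
apply: ler_pM; rewrite ?nrm_ge0 //; first by rewrite mulr_ge0 ?nrm_ge0.
  by rewrite ler_wpM2l //; exact: M1.
exact: M0'.
Qed.

(** With x = (B - i)^{-1} F and x0 = (B0 - i)^{-1} F0, the difference splits into ((B - i)^{-1} -
    (B0 - i)^{-1}) F, controlled by [r], and (B0 - i)^{-1} (F - F0), which sees the resolvents only
    in the norm of [H], where [dR] is available. *)
Lemma resolventD_difference_le (v C r k dR : R) : 0 <= C -> 0 <= r -> 0 <= v ->
  0 <= dR -> nrm z + 1 + v <= k ->
  opbd V v -> opbd (resolventD iota B0 'i) C ->
  opbd (resolventD iota B 'i \- resolventD iota B0 'i) r ->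
  opbd (resolvent H1 z) M -> opbd (resolvent H0 z) M ->
  opbd (resolvent H1 z \- resolvent H0 z) dR ->
  opbd (resolventD iota H1 z \- resolventD iota H0 z)
    (r * (1 + k * M) + C * (k * dR + d * M)).
Proof.
move=> C0 r0 v0 dR0 kz V_bd C_bd r_bd R1M R0M Rd f.
have k0 : 0 <= k by apply: le_trans kz; rewrite !addr_ge0 ?nrm_ge0.
have [_ hV _] := cl.
pose x := resolventD iota H1 z f; pose x0 := resolventD iota H0 z f.
have xE : iota x = resolvent H1 z f.
  by apply: iota_resolventD Hz; exact: bd1.(bd_dom).
have x0E : iota x0 = resolvent H0 z f.
  by apply: iota_resolventD Hz0; exact: bd0.(bd_dom).
have [xd xR] := resolvent_spec f Hz; have [x0d x0R] := resolvent_spec f Hz0.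
have Bx : dom B (iota x) by rewrite xE.
have Bx0 : dom B0 (iota x0) by rewrite x0E.
have Ex := resolventD_perturb iota_inj bd1 z Bx.
have Ex0 := resolventD_perturb iota_inj bd0 z Bx0.
rewrite -/H1 xE xR in Ex; rewrite -/H0 x0E x0R in Ex0.
rewrite /= -/x -/x0 Ex Ex0.
set u := resolvent H1 z f in Ex *; set u0 := resolvent H0 z f in Ex0 *.
set F := f + (z - 'i) *: u - V u; set F0 := f + (z - 'i) *: u0 - V0 u0.
apply: (le_trans (nrm_dist_triangle (resolventD iota B0 'i F) _ _)).
have lB0 : linear (resolventD iota B0 'i).
  by apply: resolventD_linear (resolvent_set_i bd0.(bd_sa)) => //; exact: bd0.(bd_dom).
rewrite -(linearP_B lB0) mulrDl; apply: lerD.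
  apply: (le_trans (r_bd F)); rewrite -mulrA ler_wpM2l //.
  apply: (le_trans (nrmB _ _)); apply: (le_trans (lerD (nrmD _ _) (V_bd _))).
  rewrite nrmZ -addrA [leRHS]mulrDl mul1r lerD2l -mulrDl.
  apply: (@le_trans _ _ (k * nrm u)).
    rewrite ler_wpM2r ?nrm_ge0 //; apply: le_trans kz; rewrite lerD2r.
    by have := nrmB z 'i; rewrite nrmi.
  by rewrite -mulrA ler_wpM2l //; exact: R1M.
apply: (le_trans (C_bd _)); rewrite -mulrA ler_wpM2l //.
have -> : F - F0 = (z - 'i) *: (u - u0) - V (u - u0) - (V u0 - V0 u0).
  rewrite /F /F0 (linearP_B bd1.(bd_V).1.1) scalerBr !opprD !opprK !addrA.
  rewrite [LHS](ACl (1*4*2*5*3*6)) /= subrr add0r.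
  by rewrite [RHS](ACl (1*2*3*(4*5)*6)) /= subrr addr0.
apply: (le_trans (nrmB _ _)); rewrite [leRHS]mulrDl; apply: lerD.
  apply: (le_trans (nrmB _ _)); apply: (le_trans (lerD (lexx _) (V_bd _))).
  rewrite nrmZ -mulrDl -mulrA.
  apply: ler_pM; rewrite ?nrm_ge0 ?addr_ge0 ?nrm_ge0 //; last exact: Rd.
  apply: le_trans kz; rewrite lerD2r.
  by have := nrmB z 'i; rewrite nrmi.
apply: (le_trans (hV _)); rewrite -mulrA ler_wpM2l //; exact: R0M.
Qed.

Variables (T' : D -> hsum K K) (Q' : hsum K K -> hsum K K) (V' : H -> H).
Variables (h N : R).
Hypotheses (N_ge0 : 0 <= N) (T'_lin : linear T') (Q'_lin : linear Q') (V'_lin : linear V').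
Hypotheses (T'_bd : opbd T' N) (Q'_bd : opbd Q' N) (V'_bd : opbd V' N).
Hypotheses (T'_d : opbd (fun x => T x - T0 x - h%:C *: T' x) (d * `|h|))
  (Q'_d : opbd (fun x => Q x - Q0 x - h%:C *: Q' x) (d * `|h|))
  (V'_d : opbd (fun x => V x - V0 x - h%:C *: V' x) (d * `|h|)).
Hypotheses (RD_d : opbd (resolventD iota H1 z \- resolventD iota H0 z) d).

(** Summands for trace, projection and potential. Next to [M] stands the first-order remainder of a
    family; the [N] parts are its derivative applied to the increment of the argument. *)
Definition expansion_const : R :=
  (M + N) * (cT * M) + ((cT + 1) * M + N * (M + cT)) * (cT * M)
  + (ci * M + N * ci) * (ci * M).

Lemma trace_resolvent_linear :
  linear (T0 \o resolventD iota H0 z^*%C).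
Proof.
have saH0 : selfadjoint H0 := selfadjoint_perturb bd0.(bd_sa) bd0.(bd_V).
move=> a f g /=; rewrite resolventD_linear ?bd0.(bd_T) //; first exact: bd0.(bd_dom).
exact: resolvent_set_conj.
Qed.

(** The adjoint of T0 R_0(conj z) moves onto [g], giving a weak form that matches
    [resolvent_difference] term by term. *)
Lemma resolvent_variation_dot f g :
  let x0 := resolventD iota H0 z f in let y := resolventD iota H0 z^*%C g in
  hdot (resolvent_variation iota T0 H0 V' Q' T' z f) g =
  hdot (J (T' x0)) (T0 y) + hdot (Q' (J (T0 x0))) (T0 y)
  - hdot (V' (iota x0)) (iota y).
Proof.
move=> x0 y.
have saH0 : selfadjoint H0 := selfadjoint_perturb bd0.(bd_sa) bd0.(bd_V).
have Hz0' := resolvent_set_conj saH0 Hz0.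
have x0E : iota x0 = resolvent H0 z f.
  by apply: iota_resolventD Hz0; exact: bd0.(bd_dom).
have yE : iota y = resolvent H0 z^*%C g.
  by apply: iota_resolventD Hz0'; exact: bd0.(bd_dom).
have adj w : hdot (bounded_adjoint (T0 \o resolventD iota H0 z^*%C) w) g = hdot w (T0 y).
  rewrite dotC -(bounded_adjointP trace_resolvent_linear (opbd_comp cT0 T0_bd M0')).
  by rewrite -dotC.
rewrite /resolvent_variation !dotDl dotNl !adj (resolvent_adjoint _ _ saH0 Hz0).
by rewrite -x0E -yE -/x0; ring.
Qed.

Lemma resolvent_variation_bounded :
  bounded_op (resolvent_variation iota T0 H0 V' Q' T' z).
Proof.
have bT' : bounded_op T' := opbd_bounded_op T'_lin N_ge0 T'_bd.
have bQ' : bounded_op Q' := opbd_bounded_op Q'_lin N_ge0 Q'_bd.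
have bV' : bounded_op V' := opbd_bounded_op V'_lin N_ge0 V'_bd.
have bT0 : bounded_op T0 := opbd_bounded_op bd0.(bd_T) cT0 T0_bd.
have bJ : bounded_op (@J R K).
  apply: (opbd_bounded_op J_linear ler01) => w.
  by rewrite nrm_J mul1r.
have bR : bounded_op (resolvent H0 z) := Hz0.2.
have bRD : bounded_op (resolventD iota H0 z).
  have dB0 : dom H0 `<=` range iota := bd0.(bd_dom).
  have [c c0 hc] := resolventD_bounded iota_inj iota_bd dB0 Hz0.
  exact: opbd_bounded_op (resolventD_linear iota_inj dB0 Hz0) c0 hc.
have TR_bd := opbd_comp cT0 T0_bd M0'.
have bTR : bounded_op (bounded_adjoint (T0 \o resolventD iota H0 z^*%C)).
  apply: opbd_bounded_op (mulr_ge0 cT0 M_ge0) _.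
    exact: bounded_adjoint_linear trace_resolvent_linear TR_bd.
  by apply: bounded_adjoint_opbd trace_resolvent_linear _ TR_bd; rewrite mulr_ge0.
rewrite /resolvent_variation; apply: bounded_op_add; first apply: bounded_op_add.
- exact: bounded_op_opp (bounded_op_comp bR (bounded_op_comp bV' bR)).
- exact: bounded_op_comp bTR
    (bounded_op_comp bQ' (bounded_op_comp bJ (bounded_op_comp bT0 bRD))).
- exact: bounded_op_comp bTR (bounded_op_comp bJ (bounded_op_comp bT' bRD)).
Qed.

Lemma resolvent_expansion_le :
  opbd (fun f => resolvent H1 z f - (resolvent H0 z f
          + h%:C *: resolvent_variation iota T0 H0 V' Q' T' z f))
    (expansion_const * d * `|h|).
Proof.
have ec0 : 0 <= expansion_const by rewrite /expansion_const !(addr_ge0, mulr_ge0).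
move=> f; apply: nrm_le_dot; first by rewrite !mulr_ge0 ?nrm_ge0.
move=> g; rewrite opprD addrA dotBl dotZl.
rewrite resolvent_difference resolvent_variation_dot.
set x := resolventD iota H1 z f; set x0 := resolventD iota H0 z f.
set y := resolventD iota H0 z^*%C g.
have [hT hV hQ] := cl.
have dx : nrm (x - x0) <= d * nrm f by exact: RD_d.
have hx : nrm x <= M * nrm f by exact: M1.
have hy : nrm y <= M * nrm g by exact: M0'.
have h0 : 0 <= `|h| by [].
have nf := nrm_ge0 f; have ng := nrm_ge0 g.
have E1 : hdot (J (T x - T0 x)) (T0 y) - h%:C * hdot (J (T' x0)) (T0 y) =
    hdot (J ((T x - T0 x - h%:C *: T' x) + h%:C *: T' (x - x0))) (T0 y).
  rewrite -dotZl -(linearP_Z J_linear) -dotBl -(linearP_B J_linear).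
  by rewrite (linearP_B T'_lin) scalerBr addrA subrK.
(* Here trace and resolvent both vary under [Q']: T x - T0 x0 = (T x - T0 x) + T0 (x - x0). *)
have E2 : hdot (Q (J (T x)) - Q0 (J (T x))) (T0 y)
      - h%:C * hdot (Q' (J (T0 x0))) (T0 y) =
    hdot ((Q (J (T x)) - Q0 (J (T x)) - h%:C *: Q' (J (T x)))
          + h%:C *: Q' (J ((T x - T0 x) + T0 (x - x0)))) (T0 y).
  rewrite -dotZl -dotBl (linearP_B bd0.(bd_T)) addrA subrK.
  by rewrite (linearP_B J_linear) (linearP_B Q'_lin) scalerBr addrA subrK.
have E3 : hdot (V (iota x) - V0 (iota x)) (iota y) - h%:C * hdot (V' (iota x0)) (iota y) =
    hdot ((V (iota x) - V0 (iota x) - h%:C *: V' (iota x))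
          + h%:C *: V' (iota (x - x0))) (iota y).
  rewrite -dotZl -dotBl linearB (linearP_B V'_lin) scalerBr.
  by rewrite addrA subrK.
have b1 : nrm (hdot (J ((T x - T0 x - h%:C *: T' x) + h%:C *: T' (x - x0))) (T0 y))
    <= (d * `|h| * (M * nrm f) + `|h| * (N * (d * nrm f))) * (cT * (M * nrm g)).
  apply: (le_trans (cauchy_schwarz _ _)); rewrite nrm_J.
  apply: ler_pM; rewrite ?nrm_ge0 //; last by apply: (le_trans (T0_bd _)); rewrite ler_wpM2l.
  apply: (le_trans (nrmD _ _)); apply: lerD.
    by apply: (le_trans (T'_d _)); rewrite ler_wpM2l // mulr_ge0.
  by rewrite nrmZr ler_wpM2l //; apply: (le_trans (T'_bd _)); rewrite ler_wpM2l.
have hTx : nrm (T x) <= (cT + 1) * (M * nrm f).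
  by apply: (le_trans (close_T_bd d_le1 cl T0_bd x)); rewrite ler_wpM2l // addr_ge0.
have b2 : nrm (hdot ((Q (J (T x)) - Q0 (J (T x)) - h%:C *: Q' (J (T x)))
          + h%:C *: Q' (J ((T x - T0 x) + T0 (x - x0)))) (T0 y))
    <= (d * `|h| * ((cT + 1) * (M * nrm f))
        + `|h| * (N * (d * (M * nrm f) + cT * (d * nrm f)))) * (cT * (M * nrm g)).
  apply: (le_trans (cauchy_schwarz _ _)).
  apply: ler_pM; rewrite ?nrm_ge0 //; last by apply: (le_trans (T0_bd _)); rewrite ler_wpM2l.
  apply: (le_trans (nrmD _ _)); apply: lerD.
    by apply: (le_trans (Q'_d _)); rewrite ler_wpM2l ?mulr_ge0 // nrm_J.
  rewrite nrmZr ler_wpM2l //; apply: (le_trans (Q'_bd _)); rewrite ler_wpM2l // nrm_J.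
  apply: (le_trans (nrmD _ _)); apply: lerD.
    by apply: (le_trans (hT x)); rewrite ler_wpM2l.
  by apply: (le_trans (T0_bd _)); rewrite ler_wpM2l.
have b3 : nrm (hdot ((V (iota x) - V0 (iota x) - h%:C *: V' (iota x))
          + h%:C *: V' (iota (x - x0))) (iota y))
    <= (d * `|h| * (ci * (M * nrm f)) + `|h| * (N * (ci * (d * nrm f)))) * (ci * (M * nrm g)).
  have hi w c : nrm w <= c -> nrm (iota w) <= ci * c.
    by move=> wc; apply: (le_trans (iota_bd w)); rewrite ler_wpM2l.
  apply: (le_trans (cauchy_schwarz _ _)).
  apply: ler_pM; rewrite ?nrm_ge0 ?hi //.
  apply: (le_trans (nrmD _ _)); apply: lerD.
    by apply: (le_trans (V'_d _)); rewrite ler_wpM2l ?mulr_ge0 ?hi.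
  by rewrite nrmZr ler_wpM2l //; apply: (le_trans (V'_bd _)); rewrite ler_wpM2l ?hi.
have -> : expansion_const * d * `|h| * nrm f * nrm g =
  (d * `|h| * (M * nrm f) + `|h| * (N * (d * nrm f))) * (cT * (M * nrm g))
  + (d * `|h| * ((cT + 1) * (M * nrm f))
        + `|h| * (N * (d * (M * nrm f) + cT * (d * nrm f)))) * (cT * (M * nrm g))
  + (d * `|h| * (ci * (M * nrm f)) + `|h| * (N * (ci * (d * nrm f)))) * (ci * (M * nrm g)).
  by rewrite /expansion_const; ring.
move: b1 b2 b3; rewrite -E1 -E2 -E3 => b1 b2 b3.
apply: le_trans (lerD (lerD b1 b2) b3).
apply: le_trans (lerD (nrmD _ _) (lexx _)).
apply: le_trans (nrmB _ _).
rewrite le_eqVlt; apply/orP; left; apply/eqP; congr nrm; ring.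
Qed.

End TwoOperators.

(** The constants precede the quantifier over [T], [Q], [B], [V], which is the source of uniformity
    in [t]. The bound at conj z serves the test vector R_0(conj z) g. *)
Theorem stable_resolvent_bounds (T0 : D -> hsum K K) (Q0 : hsum K K -> hsum K K)
    (B0 : operator H) (V0 : H -> H) (cT v C : R) (z0 : R[i]) :
  boundary_data A iota T0 Q0 B0 V0 ->
  0 <= cT -> opbd T0 cT -> 0 <= v -> opbd V0 v -> 0 <= C ->
  opbd (resolventD iota B0 'i) C -> resolvent_set (perturb B0 V0) z0 ->
  exists eps delta M : R,
  [/\ 0 < eps, 0 < delta, eps <= 1, delta <= 1 & 0 <= M /\
    forall T Q B V (d : R), boundary_data A iota T Q B V ->
      opbd (resolventD iota B 'i) C ->
      0 <= d -> d <= delta -> close_data T0 T Q0 Q V0 V d ->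
      forall z : R[i], nrm (z - z0) <= eps ->
      [/\ resolvent_set (perturb B V) z, opbd (resolvent (perturb B V) z) M,
          opbd (resolventD iota (perturb B V) z) M &
          opbd (resolventD iota (perturb B V) z^*%C) M]].
Proof.
move=> bd0 cT0 T0_bd v0 V0_bd C0 C_bd Hz0.
have [eps [delta [M [eps0 delta0 eps1 delta1 [M0 low]]]]] :=
  stable_lower_bound A_dense iota_inj ci0 iota_bd bd0 cT0 T0_bd v0 V0_bd C0 Hz0.
pose k := nrm z0 + 3 + v; have k0 : 0 <= k by rewrite !addr_ge0 ?nrm_ge0.
have M'0 : 0 <= C * (1 + k * M) by rewrite mulr_ge0 // addr_ge0 // mulr_ge0.
exists eps, delta, (M + C * (1 + k * M)); split=> //; split; first by rewrite addr_ge0.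
move=> T Q B V d bd CB d0 dd cl z zz.
have saH := selfadjoint_perturb bd.(bd_sa) bd.(bd_V).
have [Hz HM] := selfadjoint_resolvent saH M0 (low T Q B V d bd CB d0 dd cl z zz).
have Vbd : opbd V (v + 1).
  move=> w; have [_ h _] := cl; have := h w; have := V0_bd w.
  have := nrmD (V w - V0 w) (V0 w); rewrite subrK /=.
  have := nrm_ge0 w; set p := nrm _; set q := nrm _; set r := nrm _; set s := nrm _.
  move=> p0 h1 h2 h3; have : d * p <= 1 * p by rewrite ler_wpM2r // (le_trans dd).
  lra.
have v10 : 0 <= v + 1 by rewrite addr_ge0.
have RD w : nrm w = nrm z -> resolvent_set (perturb B V) w ->
    opbd (resolvent (perturb B V) w) M ->
    opbd (resolventD iota (perturb B V) w) (M + C * (1 + k * M)).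
  move=> wz Hw HwM.
  apply: opbd_le (resolventD_perturb_opbd iota_inj bd C0 v10 CB Vbd Hw M0 HwM).
  rewrite ler_wpDl // ler_wpM2l // lerD2l ler_wpM2r // wz.
  have := nrmD (z - z0) z0; rewrite subrK /k; lra.
split=> //; first by apply: opbd_le HM; rewrite lerDl.
  exact: RD.
apply: RD; [exact: nrmJ | exact: resolvent_set_conj |].
exact: resolvent_opbd_conj.
Qed.

End ResolventPerturbation.

Lemma sub_scaleD (S : pzRingType) (V : lmodType S) (a : S) (p q r s : V) :
  a *: p + q - (a *: r + s) = a *: (p - r) + (q - s).
Proof. by rewrite opprD addrACA scalerBr. Qed.

(** * Limits of operator families *)

Section PuncturedLimits.
Context {R : realType}.
Variable t0 : R.

Lemma at01P (P : R -> Prop) : (\forall t \near at01 t0, P t) <->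
  exists2 e : R, 0 < e &
    forall t : R, 0 <= t <= 1 -> t != t0 -> `|t - t0| < e -> P t.
Proof.
rewrite /at01 /within /= nearE /=; split.
- move=> /nbhs_ballP[e /= e0 he]; exists e => // t t01 tt0 te.
  by apply: (he t) => //=; rewrite /ball /= distrC.
- move=> [e e0 he]; apply/nbhs_ballP; exists e => //= t te tt0 t01.
  by apply: he => //; move: te; rewrite /ball /= distrC.
Qed.

#[global] Instance at01_filter : Filter (at01 t0).
Proof. by apply: within_filter. Qed.

Lemma at01_near (e : R) : 0 < e ->
  \forall t \near at01 t0, [/\ 0 <= t <= 1, t != t0 & `|t - t0| < e].
Proof. by move=> e0; apply/at01P; exists e. Qed.

Context {U V : normedModType R[i]}.
Implicit Types F : R -> U -> V.

Lemma opnorm_cvg0 (G : R -> U -> V) :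
  opnorm (G t) @[t --> at01 t0] --> 0%E ->
  forall e : R, 0 < e -> \forall t \near at01 t0, (opnorm (G t) <= e%:E)%E.
Proof.
move=> G0 e e0.
have h0 : nbhs (0%E : \bar R) [set x | (x < e%:E)%E].
  by apply: open_nbhs_nbhs; split; [exact: open_ereal_lt_ereal | rewrite /= lte_fin].
have : \forall t \near at01 t0, (opnorm (G t) < e%:E)%E := G0 _ h0.
by apply: filterS => t /ltW.
Qed.

Lemma cvg0_opnorm (G : R -> U -> V) :
  (forall e : R, 0 < e -> \forall t \near at01 t0, (opnorm (G t) <= e%:E)%E) ->
  opnorm (G t) @[t --> at01 t0] --> 0%E.
Proof.
move=> h S; rewrite /nbhs /= => /nbhs_ballP[e /= e0 he].
have e20 : 0 < e / 2 by rewrite divr_gt0.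
apply: filterS (h _ e20) => t Gt.
rewrite /= in Gt *; move: (opnorm_ge0 (G t)) Gt.
case: (opnorm (G t)) => [r||] //; rewrite !lee_fin => r0 rt.
apply: he; rewrite /ball /= sub0r normrN ger0_norm //; lra.
Qed.

Hypothesis t0_01 : 0 <= t0 <= 1.

Lemma opnorm_sub_opbd F (c : R -> R) : (forall t, 0 <= t <= 1 -> linear (F t)) ->
  (\forall t \near at01 t0, (opnorm (F t \- F t0) <= (c t)%:E)%E) ->
  \forall t \near at01 t0, opbd (F t \- F t0) (c t).
Proof.
move=> lF h; apply: (filterS _ (filterI h (at01_near ltr01))) => t [ht [t01 _ _]].
apply: opbd_opnorm ht => a x y /=.
by rewrite !lF // sub_scaleD.
Qed.

Lemma op_continuous_opbd F : (forall t, 0 <= t <= 1 -> linear (F t)) ->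
  op_continuous F t0 ->
  forall e : R, 0 < e -> \forall t \near at01 t0, opbd (F t \- F t0) e.
Proof.
move=> lF cF e e0; apply: (opnorm_sub_opbd (c := fun=> e)) => //.
exact: opnorm_cvg0 cF e e0.
Qed.

Lemma op_lipschitz_opbd F : (forall t, 0 <= t <= 1 -> linear (F t)) ->
  op_lipschitz F t0 ->
  exists2 c : R, 0 <= c & \forall t \near at01 t0, opbd (F t \- F t0) (c * `|t - t0|).
Proof.
move=> lF [c hc]; exists `|c| => //.
have := opnorm_sub_opbd (c := fun t => c * `|t - t0|) lF hc.
by apply: filterS => t; apply: opbd_le; rewrite ler_wpM2r ?ler_norm.
Qed.

Lemma op_derivative_opbd F (F' : U -> V) : (forall t, 0 <= t <= 1 -> linear (F t)) ->
  op_derivative F t0 F' ->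
  forall e : R, 0 < e -> \forall t \near at01 t0,
    opbd (fun x => F t x - F t0 x - (t - t0)%:C *: F' x) (e * `|t - t0|).
Proof.
move=> lF [[lF' _] dF] e e0.
apply: (filterS _ (filterI (opnorm_cvg0 dF e0) (at01_near ltr01))) => t [ht [t01 tt0 _]] x.
have h0 : t - t0 != 0 by rewrite subr_eq0.
have -> : F t x - F t0 x - (t - t0)%:C *: F' x =
    (t - t0)%:C *: ((t - t0)%:C^-1 *: (F t x - F t0 x) - F' x).
  rewrite scalerBr scalerA mulfV ?scale1r //.
  by apply: contra_neq h0 => /(@realC_inj R _ 0).
rewrite nrmZr mulrC [leRHS]mulrAC ler_wpM2r //.
apply: (opbd_opnorm _ ht) => a u w /=.
rewrite !lF // lF' sub_scaleD scalerDr scalerA mulrC -scalerA.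
by rewrite sub_scaleD.
Qed.

Lemma op_derivative_sub_opbd F (F' : U -> V) (N : R) :
  (forall t, 0 <= t <= 1 -> linear (F t)) -> op_derivative F t0 F' -> 0 <= N -> opbd F' N ->
  forall e : R, 0 < e -> \forall t \near at01 t0, opbd (F t \- F t0) e.
Proof.
move=> lF dF N0 F'N e e0.
have N1 : 0 < N + 1 by rewrite ltr_wpDl.
(* A remainder of at most |t - t0| plus the derivative gives [(N + 1) * |t - t0|], whence the radius
   [e / (N + 1)]. *)
apply: (filterS _ (filterI (op_derivative_opbd lF dF ltr01) (at01_near (divr_gt0 e0 N1)))).
move=> t [ht [_ _]]; rewrite ltr_pdivlMr // => te x /=.
have := nrmD (F t x - F t0 x - (t - t0)%:C *: F' x) ((t - t0)%:C *: F' x).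
rewrite subrK => /le_trans; apply.
apply: (le_trans (lerD (ht x) (lexx _))); rewrite nrmZr.
have h1 : `|t - t0| * nrm (F' x) <= `|t - t0| * (N * nrm x) by rewrite ler_wpM2l.
apply: (le_trans (lerD (lexx _) h1)).
have -> : 1 * `|t - t0| * nrm x + `|t - t0| * (N * nrm x)
  = `|t - t0| * (N + 1) * nrm x by ring.
by rewrite ler_wpM2r ?nrm_ge0 // ltW.
Qed.

Lemma opbd_op_derivative F (F' : U -> V) : bounded_op F' ->
  (forall e : R, 0 < e -> \forall t \near at01 t0,
    opbd (fun x => F t x - (F t0 x + (t - t0)%:C *: F' x)) (e * `|t - t0|)) ->
  op_derivative F t0 F'.
Proof.
move=> bF' h; split=> //; apply: cvg0_opnorm => e e0.
apply: (filterS _ (filterI (h e e0) (at01_near ltr01))) => t [ht [t01 tt0 _]].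
apply: opnorm_le (ltW e0) _ => x.
have h0 : t - t0 != 0 by rewrite subr_eq0.
have hp : 0 < `|t - t0| by rewrite normr_gt0.
rewrite -(ler_pM2l hp) -nrmZr scalerBr scalerA mulfV; last first.
  by apply: contra_neq h0 => /(@realC_inj R _ 0).
by rewrite scale1r -addrA -opprD mulrA [_ * e]mulrC; exact: ht.
Qed.

End PuncturedLimits.

(** * Uniform estimates near the base point *)

Section Families.
Context {R : realType} {H K : hilbertType R} {D : completeNormedModType R[i]}.
Variables (A : operator H) (iota : {linear D -> H}) (ci : R).
Hypotheses (A_dense : densely_defined A) (iota_inj : injective iota).
Hypotheses (ci0 : 0 <= ci) (iota_bd : opbd iota ci).
Variables (T : R -> D -> hsum K K) (Q : R -> hsum K K -> hsum K K).
Variables (At : R -> operator H) (V : R -> H -> H).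
Hypothesis bdt : forall t : R, 0 <= t <= 1 ->
  boundary_data A iota (T t) (Q t) (At t) (V t).
Variables (t0 : R) (z0 : R[i]).
Hypothesis t0_01 : 0 <= t0 <= 1.
Let Ht t := perturb (At t) (V t).
Let AtD t := resolventD iota (At t) 'i.
Let RD t z := resolventD iota (Ht t) z.
Let close t (d : R) := close_data (T t0) (T t) (Q t0) (Q t) (V t0) (V t) d.
Hypothesis Hz0 : resolvent_set (Ht t0) z0.
Variables (cT v C : R).
Hypotheses (cT0 : 0 <= cT) (T0_bd : opbd (T t0) cT).
Hypotheses (v0 : 0 <= v) (V0_bd : opbd (V t0) v).
Hypotheses (C0 : 0 <= C) (C_bd : opbd (AtD t0) C).

Lemma linear_AtD t : 0 <= t <= 1 -> linear (AtD t).
Proof.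
move=> t01; have bd := bdt t01; apply: resolventD_linear => //; first exact: bd.(bd_dom).
exact: resolvent_set_i bd.(bd_sa).
Qed.

Lemma close_self : close t0 0.
Proof. by split=> x; rewrite /= subrr nrm0 mul0r. Qed.

Lemma close_le t (d d' : R) : d <= d' -> close t d -> close t d'.
Proof. by move=> dd' [hT hV hQ]; split; apply: opbd_le dd' _. Qed.

Hypothesis AtD_bd : \forall t \near at01 t0, opbd (AtD t) C.
Hypothesis close_small : forall e : R, 0 < e -> \forall t \near at01 t0, close t e.

(** [d] stays free in the last clause, so one [L] serves continuity, the Lipschitz bound and the
    expansion. *)
Lemma uniform_resolvent_bounds : exists eps M L : R,
  [/\ 0 < eps, eps <= 1, 0 <= M, 0 <= L &
   (forall t, 0 <= t <= 1 -> `|t - t0| <= eps ->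
     forall z : R[i], nrm (z - z0) <= eps ->
     [/\ resolvent_set (Ht t) z, opbd (resolvent (Ht t) z) M,
         opbd (RD t z) M & opbd (RD t z^*%C) M]) /\
   (forall t (d : R), 0 <= t <= 1 -> `|t - t0| <= eps -> 0 <= d -> d <= 1 ->
     close t d -> forall z : R[i], nrm (z - z0) <= eps ->
     opbd (resolvent (Ht t) z \- resolvent (Ht t0) z) (L * d))].
Proof.
have [eps [delta [M [eps0 delta0 eps1 delta1 [M0 hM]]]]] :=
  stable_resolvent_bounds A_dense iota_inj ci0 iota_bd (bdt t0_01) cT0 T0_bd v0 V0_bd
    C0 C_bd Hz0.
have [r r0 hr] := (at01P t0 _).1 (filterI AtD_bd (close_small delta0)).
(* The box is closed while the filter gives |t - t0| < [r], hence the half. *)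
pose eps' := Num.min (r / 2) eps.
have eps'0 : 0 < eps' by rewrite lt_min eps0 divr_gt0.
have eps'r : eps' < r by rewrite gt_min ltr_pdivrMr // mulr_natr mulr2n ltrDl r0.
have eps'e : eps' <= eps by rewrite ge_min lexx orbT.
have bounds t : 0 <= t <= 1 -> `|t - t0| <= eps' ->
    forall z : R[i], nrm (z - z0) <= eps' ->
    [/\ resolvent_set (Ht t) z, opbd (resolvent (Ht t) z) M,
        opbd (RD t z) M & opbd (RD t z^*%C) M].
  move=> t01 tt0 z zz; have zz' := le_trans zz eps'e.
  (* The punctured filter is silent at [t0], where the data are at distance 0 from themselves. *)
  have [t_eq|t_neq] := eqVneq t t0.
    rewrite t_eq.
    exact: (hM _ _ _ _ 0 (bdt t0_01) C_bd (lexx _) (ltW delta0) close_self z zz').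
  have [CB cl] := hr t t01 t_neq (le_lt_trans tt0 eps'r).
  exact: (hM _ _ _ _ delta (bdt t01) CB (ltW delta0) (lexx _) cl z zz').
exists eps', M, (krein_const ci cT * M * M); split=> //.
- exact: le_trans eps'e eps1.
- by rewrite !mulr_ge0 ?krein_const_ge0.
split=> // t d t01 tt0 d0 d1 cl z zz.
have [Hz0t _ _ RD0] : [/\ resolvent_set (Ht t0) z, opbd (resolvent (Ht t0) z) M,
    opbd (RD t0 z) M & opbd (RD t0 z^*%C) M].
  by apply: bounds => //; rewrite subrr normr0 ltW.
have [Hzt _ RDt _] := bounds t t01 tt0 z zz.
exact: (resolvent_difference_le A_dense ci0 iota_bd (bdt t0_01) (bdt t01)).
Qed.

(** The bounds are premises so that [eps] may still be shrunk. *)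
Lemma stable_family (eps M L : R) : 0 < eps -> 0 <= L ->
   (forall t, 0 <= t <= 1 -> `|t - t0| <= eps ->
     forall z : R[i], nrm (z - z0) <= eps ->
     [/\ resolvent_set (Ht t) z, opbd (resolvent (Ht t) z) M,
         opbd (RD t z) M & opbd (RD t z^*%C) M]) ->
   (forall t (d : R), 0 <= t <= 1 -> `|t - t0| <= eps -> 0 <= d -> d <= 1 ->
     close t d -> forall z : R[i], nrm (z - z0) <= eps ->
     opbd (resolvent (Ht t) z \- resolvent (Ht t0) z) (L * d)) ->
  stable_resolvent Ht t0 z0 eps.
Proof.
move=> eps0 L0 hM hL; split.
  move=> t z [/= t01 tt0]; rewrite nrmE lecR => zz.
  by have [Hz _ _ _] := hM t t01 tt0 z zz; apply.
move=> e e0.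
pose d := Num.min 1 (e / (L + 1)).
have L1 : 0 < L + 1 by rewrite ltr_wpDl.
have d0 : 0 < d by rewrite lt_min ltr01 divr_gt0.
have d1 : d <= 1 by rewrite ge_min lexx.
have de : L * d <= e.
  apply: (@le_trans _ _ ((L + 1) * d)); first by rewrite ler_wpM2r ?lerDl // ltW.
  by rewrite mulrC -ler_pdivlMr // ge_min lexx orbT.
apply: (filterS _ (filterI (close_small d0) (at01_near t0 eps0))) => t [cl [t01 _ te]] z.
rewrite nrmE ltcR => zz; apply: opnorm_le; first exact: ltW.
by apply: opbd_le de _; apply: hL => //; apply: ltW.
Qed.

Section Derivative.
Variables (T' : D -> hsum K K) (V' : H -> H) (Q' : hsum K K -> hsum K K) (N : R).
Hypotheses (AtD_small : forall e : R, 0 < e ->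
  \forall t \near at01 t0, opbd (AtD t \- AtD t0) e).
Hypotheses (N_ge0 : 0 <= N) (T'_lin : linear T') (Q'_lin : linear Q') (V'_lin : linear V').
Hypotheses (T'_bd : opbd T' N) (Q'_bd : opbd Q' N) (V'_bd : opbd V' N).
Hypotheses
  (T'_d : forall e : R, 0 < e -> \forall t \near at01 t0,
    opbd (fun x => T t x - T t0 x - (t - t0)%:C *: T' x) (e * `|t - t0|))
  (Q'_d : forall e : R, 0 < e -> \forall t \near at01 t0,
    opbd (fun x => Q t x - Q t0 x - (t - t0)%:C *: Q' x) (e * `|t - t0|))
  (V'_d : forall e : R, 0 < e -> \forall t \near at01 t0,
    opbd (fun x => V t x - V t0 x - (t - t0)%:C *: V' x) (e * `|t - t0|)).
Let R' := resolvent_variation iota (T t0) (Ht t0) V' Q' T'.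

Lemma uniform_expansion (eps M L : R) : 0 < eps -> eps <= 1 -> 0 <= M -> 0 <= L ->
   (forall t, 0 <= t <= 1 -> `|t - t0| <= eps ->
     forall z : R[i], nrm (z - z0) <= eps ->
     [/\ resolvent_set (Ht t) z, opbd (resolvent (Ht t) z) M,
         opbd (RD t z) M & opbd (RD t z^*%C) M]) ->
   (forall t (d : R), 0 <= t <= 1 -> `|t - t0| <= eps -> 0 <= d -> d <= 1 ->
     close t d -> forall z : R[i], nrm (z - z0) <= eps ->
     opbd (resolvent (Ht t) z \- resolvent (Ht t0) z) (L * d)) ->
  forall e : R, 0 < e -> \forall t \near at01 t0,
    forall z : R[i], nrm (z - z0) <= eps ->
    opbd (fun f => resolvent (Ht t) z f
            - (resolvent (Ht t0) z f + (t - t0)%:C *: R' z f)) (e * `|t - t0|).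
Proof.
move=> eps0 eps1 M0 L0 hM hL e e0.
have [k [k0 kE]] : exists k : R, 0 <= k /\ k = nrm z0 + 3 + v.
  by exists (nrm z0 + 3 + v); rewrite !addr_ge0 ?nrm_ge0.
have [K2 [K20 K2E]] : exists K2 : R,
    0 <= K2 /\ K2 = (1 + k * M) + C * (k * L + M).
  by exists (1 + k * M + C * (k * L + M)); split=> //; rewrite !(addr_ge0, mulr_ge0).
have [E [E0 EE]] : exists E : R, 0 <= E /\ E = expansion_const ci cT M N.
  exists (expansion_const ci cT M N); split=> //.
  by rewrite /expansion_const !(addr_ge0, mulr_ge0).
have K21 : 0 < 1 + K2 by rewrite ltr_wpDr.
have E1 : 0 < 1 + E by rewrite ltr_wpDr.
(* Two scales: modulus [s] makes the final error at most [e], and the smaller [eta] imposed on the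
   data keeps the resolvents within [s] in B(H, D), since [resolventD_difference_le] at
   [r = d = eta], [dR = L * eta] gives [eta * K2]. *)
pose s := Num.min 1 (e / (1 + E)).
have s0 : 0 < s by rewrite lt_min ltr01 divr_gt0.
have s1 : s <= 1 by rewrite ge_min lexx.
have se : E * s <= e.
  apply: (@le_trans _ _ ((1 + E) * s)); first by rewrite ler_wpM2r ?lerDr // ltW.
  by rewrite mulrC -ler_pdivlMr // ge_min lexx orbT.
pose eta := s / (1 + K2).
have eta0 : 0 < eta by rewrite divr_gt0.
have etaK : eta * (1 + K2) = s by rewrite divfK // gt_eqF.
have etas : eta <= s by rewrite -etaK mulrDr mulr1 lerDl mulr_ge0 // ltW.
have etaK2 : eta * K2 <= s by rewrite -etaK mulrDr lerDr mulr1 ltW.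
have eta1 : eta <= 1 := le_trans etas s1.
apply: (filterS _ (filterI (filterI (filterI (close_small eta0) (AtD_small eta0))
  (filterI (T'_d s0) (filterI (Q'_d s0) (V'_d s0)))) (at01_near t0 eps0))).
move=> t [[[cl rt] [dT [dQ dV]]] [t01 _ te]] z zz.
have [Hz R0M _ RD0'] : [/\ resolvent_set (Ht t0) z, opbd (resolvent (Ht t0) z) M,
    opbd (RD t0 z) M & opbd (RD t0 z^*%C) M].
  by apply: hM => //; rewrite subrr normr0 ltW.
have [Hzt RtM RDt _] := hM t t01 (ltW te) z zz.
have dR := hL t eta t01 (ltW te) (ltW eta0) eta1 cl z zz.
have v10 : 0 <= v + 1 by rewrite addr_ge0.
have Vbd : opbd (V t) (v + 1).
  move=> w; have [_ h _] := cl; have := h w; have := V0_bd w.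
  have := nrmD (V t w - V t0 w) (V t0 w); rewrite subrK /=.
  have := nrm_ge0 w; set p := nrm _; set q := nrm _; set r := nrm _; set s' := nrm _.
  move=> p0 h1 h2 h3; have : eta * p <= 1 * p by rewrite ler_wpM2r.
  lra.
have kz : nrm z + 1 + (v + 1) <= k.
  have := nrmD (z - z0) z0; rewrite subrK kE; lra.
have RDd : opbd (RD t z \- RD t0 z) s.
  have Ld : 0 <= L * eta by rewrite mulr_ge0 // ltW.
  have := resolventD_difference_le iota_inj (bdt t0_01) (bdt t01) Hz Hzt (ltW eta0) cl
     C0 (ltW eta0) v10 Ld kz Vbd C_bd rt RtM R0M dR.
  apply: opbd_le; apply: le_trans etaK2; rewrite K2E le_eqVlt; apply/orP; left.
  by apply/eqP; ring.
have := resolvent_expansion_le A_dense iota_inj ci0 iota_bd (bdt t0_01) (bdt t01) Hz Hzt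
  (ltW s0) s1 (close_le etas cl) cT0 T0_bd M0 RDt RD0' N_ge0 T'_lin Q'_lin V'_lin
  T'_bd Q'_bd V'_bd dT dQ dV RDd.
by apply: opbd_le; rewrite -EE ler_wpM2r.
Qed.

End Derivative.

End Families.

(** * From the hypotheses to the three statements *)

Lemma graph_norm_bound (R : realType) (H : hilbertType R)
    (D : completeNormedModType R[i]) (A : operator H) (iota : D -> H) (c : R) :
  (forall d : D, (graph_norm A (iota d))%:C <= c%:C * `|d|) -> opbd iota `|c|.
Proof.
move=> h d; have := h d; rewrite nrmE -realCM lecR => hd.
apply: (@le_trans _ _ (graph_norm A (iota d))).
  rewrite -[leLHS]ger0_norm ?nrm_ge0 // -sqrtr_sqr; apply: ler_wsqrtr.
  by rewrite !dot_nrm -realCD /= lerDl sqr_ge0.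
by apply: (le_trans hd); rewrite ler_wpM2r ?nrm_ge0 ?ler_norm.
Qed.

Theorem theorem3p18 (R : realType)
    (H K : hilbertType R) (sepH : separable H) (sepK : separable K)
    (* the symmetric operator *)
    (A : operator H)
    (A_lin : linear_operator A) (A_dense : densely_defined A)
    (A_closed : closed_operator A) (A_sym : symmetric_operator A)
    (A_def : equal_deficiency_indices A)
    (* the Banach space D, dense in H_+ = dom A^* *)
    (D : completeNormedModType R[i]) (iota : {linear D -> H})
    (iota_inj : injective iota)
    (D_sub : range iota `<=` dom (adjoint A))
    (A_sub : dom A `<=` range iota)
    (D_dense : forall u, dom (adjoint A) u -> forall e : R, 0 < e ->
       exists d : D, graph_norm (adjoint A) (u - iota d) < e)
    (D_bounded : exists c : R, forall d : D,
       (graph_norm (adjoint A) (iota d))%:C <= c%:C * `|d|)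
    (* the trace operators T t = [Gamma_0t, Gamma_1t] *)
    (T : R -> D -> hsum K K)
    (T_bounded : forall t : R, 0 <= t <= 1 -> bounded_op (T t))
    (T_dense : forall t : R, 0 <= t <= 1 -> dense (range (T t)))
    (T_green : forall t : R, 0 <= t <= 1 -> forall u v : D,
       hdot (adjoint A (iota u)) (iota v) - hdot (iota u) (adjoint A (iota v))
       = hdot (T t u).2 (T t v).1 - hdot (T t u).1 (T t v).2)
    (* the projections Q t *)
    (Q : R -> hsum K K -> hsum K K)
    (Q_proj : forall t : R, 0 <= t <= 1 -> orthogonal_projection (Q t))
    (Q_lagr : forall t : R, 0 <= t <= 1 -> lagrangian (range (Q t)))
    (* the self-adjoint extensions *)
    (At : R -> operator H)
    (At_sa : forall t : R, 0 <= t <= 1 -> selfadjoint (At t))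
    (At_ext : forall t : R, 0 <= t <= 1 -> extends (At t) A)
    (At_dom : forall t : R, 0 <= t <= 1 -> dom (At t) `<=` range iota)
    (At_trace : forall t : R, 0 <= t <= 1 ->
       closure (T t @` (iota @^-1` dom (At t))) = range (Q t))
    (* the perturbations *)
    (V : R -> H -> H)
    (V_sa : forall t : R, 0 <= t <= 1 -> selfadjoint_bounded (V t))
    (t0 : R) (t0_01 : 0 <= t0 <= 1) (z0 : R[i]) :
  let Ht := fun t : R => perturb (At t) (V t) in
  let AtD := fun t : R => resolventD iota (At t) 'i in
  ~ spectrum (Ht t0) z0 ->
  [/\ (* (1) *)
      (exists C : R, \forall t \near at01 t0, (opnorm (AtD t) <= C%:E)%E) ->
      op_continuous T t0 -> op_continuous V t0 -> op_continuous Q t0 ->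
      exists2 eps : R, 0 < eps & stable_resolvent Ht t0 z0 eps,
      (* (2) *)
      (exists C : R, \forall t \near at01 t0, (opnorm (AtD t) <= C%:E)%E) ->
      op_lipschitz T t0 -> op_lipschitz V t0 -> op_lipschitz Q t0 ->
      exists2 eps : R, 0 < eps &
        stable_resolvent Ht t0 z0 eps /\
        exists2 c : R, 0 < c & forall (t : R) (z : R[i]), nbhd_box t0 z0 eps (t, z) ->
          (opnorm (resolvent (Ht t) z \- resolvent (Ht t0) z)
             <= (c * `|t - t0|)%:E)%E &
      (* (3) *)
      forall (T' : D -> hsum K K) (V' : H -> H) (Q' : hsum K K -> hsum K K),
      op_continuous AtD t0 ->
      op_derivative T t0 T' -> op_derivative V t0 V' ->
      op_derivative Q t0 Q' ->
      let R' := resolvent_variation iota (T t0) (Ht t0) V' Q' T' in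
      exists2 eps : R, 0 < eps &
        [/\ stable_resolvent Ht t0 z0 eps,
            forall z : R[i], `|z - z0| < eps%:C ->
              bounded_op (T t0 \o resolventD iota (Ht t0) z^*%C),
            forall e : R, 0 < e -> \forall t \near at01 t0,
              forall z : R[i], `|z - z0| < eps%:C ->
                (opnorm (fun f => resolvent (Ht t) z f
                    - (resolvent (Ht t0) z f + (t - t0)%:C *: R' z f))%R
                 <= (e * `|t - t0|)%:E)%E &
            op_derivative (fun t : R => resolvent (Ht t) z0) t0 (R' z0)]].
Proof.
move=> Ht AtD /contrapT Hz0.
have [cD D_bd] := D_bounded.
have iota_bd := graph_norm_bound D_bd.
have ci0 : 0 <= `|cD| by [].
have bdt (t : R) : 0 <= t <= 1 -> boundary_data A iota (T t) (Q t) (At t) (V t).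
  move=> t01; split.
  - exact: (T_bounded t t01).1.
  - by move=> x y; rewrite omegaE; exact: T_green.
  - exact: Q_proj.
  - move=> f g; have : range (Q t) (Q t f) by exists f.
    by rewrite Q_lagr //=; apply; exists g.
  - exact: At_sa.
  - exact: At_ext.
  - exact: At_dom.
  (* The closure of the traces is ran Q, on which [Q] is the identity. *)
  - move=> x Bx; have : closure (T t @` (iota @^-1` dom (At t))) (T t x).
      by apply: subset_closure; exists x.
    rewrite At_trace // => -[w _ <-]; exact: (Q_proj t t01).2.
  - exact: V_sa.
have T_lin (t : R) (t01 : 0 <= t <= 1) : linear (T t) := (T_bounded t t01).1.
have V_lin (t : R) (t01 : 0 <= t <= 1) : linear (V t) := (V_sa t t01).1.1.
have Q_lin (t : R) (t01 : 0 <= t <= 1) : linear (Q t) := (Q_proj t t01).1.1.1.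
have AtD_lin (t : R) (t01 : 0 <= t <= 1) := linear_AtD iota_inj bdt t01.
have [cT cT0 T0_bd] := bounded_op_opbd (T_bounded t0 t0_01).
have [v v0 V0_bd] := bounded_op_opbd (V_sa t0 t0_01).1.
(* The assumed bound concerns [t != t0]; at [t0] the closed graph theorem supplies the constant. *)
have [C0 C00 AtD0_bd] := resolventD_bounded iota_inj iota_bd (At_dom t0 t0_01)
  (resolvent_set_i (At_sa t0 t0_01)).
have AtD_bounded : (exists C : R, \forall t \near at01 t0, (opnorm (AtD t) <= C%:E)%E) ->
    exists C : R, [/\ 0 <= C, opbd (AtD t0) C & \forall t \near at01 t0, opbd (AtD t) C].
  move=> [C hC]; exists (C0 + `|C|); split; first by rewrite addr_ge0.
    by apply: opbd_le AtD0_bd; rewrite lerDl.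
  apply: (filterS _ (filterI hC (at01_near t0 ltr01))) => t [ht [t01 _ _]].
  apply: (@opbd_le _ _ _ _ C); first by rewrite ler_wpDl // ler_norm.
  by apply: opbd_opnorm ht; exact: AtD_lin.
have close_from (c : R -> R) :
    (\forall t \near at01 t0, opbd (T t \- T t0) (c t)) ->
    (\forall t \near at01 t0, opbd (V t \- V t0) (c t)) ->
    (\forall t \near at01 t0, opbd (Q t \- Q t0) (c t)) ->
    \forall t \near at01 t0,
      close_data (T t0) (T t) (Q t0) (Q t) (V t0) (V t) (c t).
  move=> hT hV hQ.
  by apply: (filterS _ (filterI hT (filterI hV hQ))) => t [? [? ?]].
split.
- move=> /AtD_bounded[C [C0' CB hC]] cT' cV cQ.
  have cl (e : R) (e0 : 0 < e) := close_from (fun=> e) (op_continuous_opbd t0_01 T_lin cT' e0)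
    (op_continuous_opbd t0_01 V_lin cV e0) (op_continuous_opbd t0_01 Q_lin cQ e0).
  have [eps [M [L [eps0 eps1 M0 L0 [hM hL]]]]] := uniform_resolvent_bounds A_dense
    iota_inj ci0 iota_bd bdt t0_01 Hz0 cT0 T0_bd v0 V0_bd C0' CB hC cl.
  by exists eps => //; exact (stable_family cl eps0 L0 hM hL).
- move=> /AtD_bounded[C [C0' CB hC]] lT lV lQ.
  have [aT aT0 hT] := op_lipschitz_opbd t0_01 T_lin lT.
  have [aV aV0 hV] := op_lipschitz_opbd t0_01 V_lin lV.
  have [aQ aQ0 hQ] := op_lipschitz_opbd t0_01 Q_lin lQ.
  pose a := aT + aV + aQ + 1.
  have a0 : 0 < a by rewrite ltr_wpDl // !addr_ge0.
  have cl_lip : \forall t \near at01 t0,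
      close_data (T t0) (T t) (Q t0) (Q t) (V t0) (V t) (a * `|t - t0|).
    apply: (close_from (fun t => a * `|t - t0|)).
    - by apply: (filterS _ hT) => t; apply: opbd_le; rewrite ler_wpM2r // /a; lra.
    - by apply: (filterS _ hV) => t; apply: opbd_le; rewrite ler_wpM2r // /a; lra.
    - by apply: (filterS _ hQ) => t; apply: opbd_le; rewrite ler_wpM2r // /a; lra.
  have cl (e : R) : 0 < e -> \forall t \near at01 t0,
      close_data (T t0) (T t) (Q t0) (Q t) (V t0) (V t) e.
    move=> e0; apply: (filterS _ (filterI cl_lip (at01_near t0 (divr_gt0 e0 a0)))).
    move=> t [clt [_ _]]; rewrite ltr_pdivlMr // mulrC => /ltW.
    by move=> te; exact: close_le te clt.
  have [eps [M [L [eps0 eps1 M0 L0 [hM hL]]]]] := uniform_resolvent_bounds A_dense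
    iota_inj ci0 iota_bd bdt t0_01 Hz0 cT0 T0_bd v0 V0_bd C0' CB hC cl.
  (* The Lipschitz bound must hold on the whole box, so the radius shrinks until the data estimate
     is valid there and the modulus [a * |t - t0|] is at most 1. *)
  have [r r0 hr] := (at01P t0 _).1 (filterI cl_lip (at01_near t0 (divr_gt0 ltr01 a0))).
  pose eps' := Num.min (r / 2) eps.
  have eps'0 : 0 < eps' by rewrite lt_min eps0 divr_gt0.
  have eps'r : eps' < r by rewrite gt_min ltr_pdivrMr // mulr_natr mulr2n ltrDl r0.
  have eps'e : eps' <= eps by rewrite ge_min lexx orbT.
  exists eps' => //; split.
    apply: (stable_family cl eps'0 L0 (M := M)).
      by move=> t t01 te z ze; apply: hM => //; apply: le_trans eps'e.
    by move=> t d t01 te d0 d1 ct z ze; apply: hL => //; apply: le_trans eps'e.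
  exists (L * a + 1); first by rewrite ltr_wpDl // mulr_ge0 // ltW.
  move=> t z [/= t01 te]; rewrite nrmE lecR => ze.
  have [->|t_neq] := eqVneq t t0.
    rewrite subrr normr0 mulr0; apply: opnorm_le => // x.
    by rewrite /= subrr nrm0 mul0r.
  have [clt [_ _ ta]] := hr t t01 t_neq (le_lt_trans te eps'r).
  apply: opnorm_le; first by rewrite mulr_ge0 // addr_ge0 // mulr_ge0 // ltW.
  have da : a * `|t - t0| <= 1 by rewrite mulrC -ler_pdivlMr // ltW.
  have da0 : 0 <= a * `|t - t0| by rewrite mulr_ge0 // ltW.
  have := hL t _ t01 (le_trans te eps'e) da0 da clt z (le_trans ze eps'e).
  by apply: opbd_le; rewrite mulrA ler_wpM2r // lerDl.
move=> T' V' Q' cAtD dT dV dQ R'.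
have [NT NT0 T'_bd] := bounded_op_opbd dT.1.
have [NV NV0 V'_bd] := bounded_op_opbd dV.1.
have [NQ NQ0 Q'_bd] := bounded_op_opbd dQ.1.
pose N := NT + NV + NQ; have N0 : 0 <= N by rewrite !addr_ge0.
have T'N : opbd T' N by apply: opbd_le T'_bd; rewrite /N; lra.
have V'N : opbd V' N by apply: opbd_le V'_bd; rewrite /N; lra.
have Q'N : opbd Q' N by apply: opbd_le Q'_bd; rewrite /N; lra.
have AtD_small := op_continuous_opbd t0_01 AtD_lin cAtD.
(* Convergence of (A_t - i)^{-1} in B(H, D) yields the uniform bound needed for stability. *)
have AtD_near : \forall t \near at01 t0, opbd (AtD t) (C0 + 1).
  apply: (filterS _ (AtD_small 1 ltr01)) => t ht x.
  have := nrmD (AtD t x - AtD t0 x) (AtD t0 x); rewrite subrK => /le_trans; apply.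
  by rewrite mulrDl addrC; apply: lerD; [exact: AtD0_bd | exact: ht].
have C10 : 0 <= C0 + 1 by rewrite addr_ge0.
have AtD0_bd' : opbd (AtD t0) (C0 + 1) by apply: opbd_le AtD0_bd; rewrite lerDl.
have cl (e : R) (e0 : 0 < e) := close_from (fun=> e)
  (op_derivative_sub_opbd t0_01 T_lin dT N0 T'N e0)
  (op_derivative_sub_opbd t0_01 V_lin dV N0 V'N e0)
  (op_derivative_sub_opbd t0_01 Q_lin dQ N0 Q'N e0).
have [eps [M [L [eps0 eps1 M0 L0 [hM hL]]]]] := uniform_resolvent_bounds A_dense
  iota_inj ci0 iota_bd bdt t0_01 Hz0 cT0 T0_bd v0 V0_bd C10 AtD0_bd' AtD_near cl.
have hM0 (z : R[i]) : nrm (z - z0) <= eps -> [/\ resolvent_set (Ht t0) z,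
    opbd (resolvent (Ht t0) z) M, opbd (resolventD iota (Ht t0) z) M &
    opbd (resolventD iota (Ht t0) z^*%C) M].
  by apply: hM => //; rewrite subrr normr0 ltW.
have expansion := uniform_expansion A_dense iota_inj ci0 iota_bd bdt t0_01 cT0 T0_bd
  v0 V0_bd C10 AtD0_bd' cl AtD_small N0 dT.1.1 dQ.1.1 dV.1.1 T'N Q'N V'N
  (op_derivative_opbd t0_01 T_lin dT) (op_derivative_opbd t0_01 Q_lin dQ)
  (op_derivative_opbd t0_01 V_lin dV)
  eps0 eps1 M0 L0 hM hL.
exists eps => //; split.
- exact (stable_family cl eps0 L0 hM hL).
- move=> z; rewrite nrmE ltcR => /ltW zz; have [Hz _ _ RD0'] := hM0 z zz.
  apply: opbd_bounded_op (mulr_ge0 cT0 M0) (opbd_comp cT0 T0_bd RD0').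
  exact (trace_resolvent_linear iota_inj (bdt t0 t0_01) Hz).
- move=> e e0; apply: (filterS _ (expansion e e0)) => t ht z.
  rewrite nrmE ltcR => /ltW zz; apply: opnorm_le (ht z zz).
  by rewrite mulr_ge0 // ltW.
(* The derivative at [z0] is the uniform expansion at the centre of the disc. *)
have z00 : nrm (z0 - z0) <= eps by rewrite subrr nrm0 ltW.
have [_ _ _ RD0'] := hM0 z0 z00.
apply: opbd_op_derivative.
  exact: (resolvent_variation_bounded iota_inj iota_bd (bdt t0 t0_01) Hz0 cT0 T0_bd M0
    RD0' N0 dT.1.1 dQ.1.1 dV.1.1 T'N Q'N V'N).
by move=> e e0; apply: (filterS _ (expansion e e0)) => t ht; exact: ht.
Qed.
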